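(* The single sample split Newey and Robins plug-in estimator $\hat\psi^{\mathrm{NR}}_k$ of $\psi(\mathbb P)=\mathbb E_{\mathbb P}[\mathrm{Cov}_{\mathbb P}(A,Y\mid X)]$ over $\mathcal P_{(\alpha,\beta)}$ (defined in the context) is minimax rate optimal when choosing $n^{\frac d{2\alpha+2\beta}}\lesssim k\lesssim n$ if $\frac{\alpha+\beta}2\ge\frac d4$, and when choosing $k\asymp n^{\frac{2d}{2\alpha+2\beta+d}}$ if $\frac{\alpha+\beta}2<\frac d4$.
   Context: Notation. $a\vee b=\max(a,b)$; integrals are over $[0,1]^d$. For nonnegative sequences, $a_n\lesssim b_n$ means there is a constant $C>0$ with $a_n\le Cb_n$ for all $n\ge n_0$; $a_n\gtrsim b_n$ means $b_n\lesssim a_n$; $a_n\asymp b_n$ means both. The resolution $k$ is a sequence that may depend on $n$. Wavelets. Fix a compactly supported Cohen–Daubechies–Vial type orthonormal wavelet basis $\{\Phi_{J_0m},\Psi^{\iota}_{lm'}: m\in\mathcal Z_{J_0},\,m'\in\mathcal Z_l,\,\iota\in\{0,1\}^d\setminus\{0\},\,l\ge J_0\}$ of $L^2([0,1]^d)$ of regularity $S\ge1$, $S>\alpha\vee\beta$, with $2^{J_0}\ge S$, $|\mathcal Z_l|\asymp 2^{ld}$. For $j\ge J_0$ let $V_j=\mathrm{span}\{\Phi_{jm}:m\in\mathcal Z_j\}$ ($\{\Phi_{jm}\}_m$ the orthonormal scaling functions at level $j$; the $V_j$ are nested). A resolution is a number $k=2^{jd}$, $j\ge J_0$; write $V_k,\Phi_{km},\mathcal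 Z_k$ for $V_j,\Phi_{jm},\mathcal Z_j$. Standard properties: $|\Phi_{km}|\lesssim\sqrt k$ uniformly with support in a set of Lebesgue measure $O(1/k)$; $V_k$ contains all polynomials of degree at most $S-1$. The projection kernel is $K_{V_k}(x,y)=\sum_{m\in\mathcal Z_k}\Phi_{km}(x)\Phi_{km}(y)$. Hölder ball. $H(\alpha,M)$ is the set of uniformly continuous $h:[0,1]^d\to\mathbb R$ with $2^{J_0(\alpha+d/2)}\max_m|\langle h,\Phi_{J_0m}\rangle|+\sup_{l\ge J_0,m\in\mathcal Z_l,\iota}2^{l(\alpha+d/2)}|\langle h,\Psi^\iota_{lm}\rangle|\le M$. Model. $\mathcal P_{(\alpha,\beta)}$ is the set of distributions $\mathbb P$ of $(X,A,Y)\in[0,1]^d\times\mathbb R\times\mathbb R$ with $X\sim\mathrm{Uniform}([0,1]^d)$, $A,Y\in[C_1,C_2]$ a.s., $p(x):=\mathbb E_{\mathbb P}[A\mid X=x]\in H(\alpha,M)$ and $b(x):=\mathbb E_{\mathbb P}[Y\mid X=x]\in H(\beta,M)$, where $C_1,C_2\in\mathbb R$, $\alpha,\beta,M>0$ are fixed known constants. The functional is $\psi(\mathbb P)=\mathbb E_{\mathbb P}[\mathrm{Cov}_{\mathbb P}(A,Y\mid X)]$. Estimator. I.i.d. observations from $\mathbb P$ are split into two disjoint subsamples $\mathcal D_1,\mathcal D_2$, each of size $n$. Put $\hat b^{(1)}_k(x)=\frac1n\sum_{i\in\mathcal D_1}Y_iK_{V_k}(X_i,x)$ and $\hat\psi^{\mathrm{NR}}_k=\frac1n\sum_{i\in\mathcal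 D_2}A_i(Y_i-\hat b^{(1)}_k(X_i))$. Rates. The (known) minimax rate for squared error over $\mathcal P_{(\alpha,\beta)}$ is $r_n^*=n^{-1}$ if $\frac{\alpha+\beta}2\ge\frac d4$ and $r_n^*=n^{-\frac{4\alpha+4\beta}{2\alpha+2\beta+d}}$ if $\frac{\alpha+\beta}2<\frac d4$. The estimator is minimax rate optimal for a choice of $k$ if $\sup_{\mathbb P\in\mathcal P_{(\alpha,\beta)}}\mathbb E_{\mathbb P}[(\hat\psi^{\mathrm{NR}}_k-\psi(\mathbb P))^2]\lesssim r_n^*$. *)

(* Defs.v *)
From HB Require Import structures.
From mathcomp Require Import all_boot all_order all_algebra.
From mathcomp Require Import all_classical all_reals all_analysis.

Set Implicit Arguments.
Unset Strict Implicit.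
Unset Printing Implicit Defensive.
Import Order.TTheory GRing.Theory Num.Theory.
Import numFieldNormedType.Exports.
Local Open Scope classical_set_scope.
Local Open Scope ring_scope.

Definition lesssim (R : realType) (a b : nat -> \bar R) : Prop :=
  exists C : R, 0 < C /\
  exists n0 : nat, forall n : nat, (n0 <= n)%N -> (a n <= C%:E * b n)%E.

Definition asympeq (R : realType) (a b : nat -> \bar R) : Prop :=
  lesssim a b /\ lesssim b a.

Definition tuple_cons d (T : measurableType d) n (z : T * n.-tuple T) :
  n.+1.-tuple T := [the n.+1.-tuple T of z.1 :: z.2].

Lemma measurable_tuple_cons d (T : measurableType d) n :
  measurable_fun [set: T * n.-tuple T] (@tuple_cons d T n).
Proof. exact: (measurable_cons measurable_fst measurable_snd). Qed.

HB.instance Definition _ d (T : measurableType d) n :=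
  isMeasurableFun.Build _ _ _ _ (@tuple_cons d T n)
    (@measurable_tuple_cons d T n).

(* The n-fold product measure of P, on tuples with the product sigma-algebra. *)
Fixpoint iid_prob d (T : measurableType d) (R : realType)
    (P : probability T R) (n : nat) : probability (n.-tuple T) R :=
  match n with
  | 0 => @dirac _ _ [tuple] R
  | n'.+1 => distribution (P \x iid_prob P n')%E (@tuple_cons d T n')
  end.

(* A function on the cube is represented by a function on R^d; its values
   outside the cube are irrelevant, because unif_cube does not charge the
   complement of the cube. *)
Definition Rvec (R : realType) (d : nat) := d.-tuple (measurableTypeR R).

Definition cube (R : realType) (d : nat) : set (Rvec R d) :=
  [set x | forall i, 0 <= tnth x i <= 1].

(* The uniform law on the cube is also Lebesgue measure restricted to it. *)
Definition unif_cube (R : realType) (d : nat) : probability (Rvec R d) R :=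
  iid_prob (@uniform_prob R 0 1 (@ltr01 R)) d.

Definition inner (R : realType) (d : nat) (f g : Rvec R d -> R) : R :=
  (\int[unif_cube R d]_x (f x * g x))%R.

Definition ae_eq_cube (R : realType) (d : nat) (f g : Rvec R d -> R) : Prop :=
  {ae unif_cube R d, forall x, f x = g x}.

(* Real polynomials in d variables of total degree at most S - 1. *)
Definition poly_fun (R : realType) (d S : nat)
    (c : {ffun 'I_d -> 'I_S} -> R) (x : Rvec R d) : R :=
  \sum_(e : {ffun 'I_d -> 'I_S} | (\sum_(i < d) e i < S)%N)
    c e * \prod_(i < d) (tnth x i) ^+ (e i).

(* The index iota ranges over {0,1}^d; the functions with iota = 0, and those
   of level below the coarsest level, are never used. *)
Record wavelet_system (R : realType) (d : nat) := WaveletSystem {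
  ws_J0 : nat;
  ws_Z : nat -> finType;
  ws_Phi : forall j : nat, ws_Z j -> Rvec R d -> R;
  ws_Psi : d.-tuple bool -> forall l : nat, ws_Z l -> Rvec R d -> R }.

Definition iota0 (d : nat) : d.-tuple bool := [tuple of nseq d false].

Section wavelets.
Context (R : realType) (d : nat) (w : wavelet_system R d).

(* The spaces V_j and W_l, as sets of representatives of classes in L^2. *)
Definition ws_V (j : nat) : set (Rvec R d -> R) :=
  [set f | exists c : ws_Z w j -> R,
    ae_eq_cube f (fun x => \sum_m c m * ws_Phi m x)].

Definition ws_W (l : nat) : set (Rvec R d -> R) :=
  [set f | exists c : d.-tuple bool -> ws_Z w l -> R,
    ae_eq_cube f
      (fun x => \sum_(i | i != iota0 d) \sum_m c i m * ws_Psi i m x)].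

Definition ws_kernel (j : nat) (x y : Rvec R d) : R :=
  \sum_(m : ws_Z w j) ws_Phi m x * ws_Phi m y.

Definition ws_comb (L : nat) (a : ws_Z w (ws_J0 w) -> R)
    (c : forall l : nat, d.-tuple bool -> ws_Z w l -> R) (x : Rvec R d) : R :=
  \sum_m a m * ws_Phi m x +
  \sum_(ws_J0 w <= l < L) \sum_(i | i != iota0 d) \sum_m
     c l i m * ws_Psi i m x.

End wavelets.

Definition resolution (d j : nat) : nat := (2 ^ (j * d))%N.

(* f is bounded by C sqrt k and carried by a set of measure at most C / k. *)
Definition localized (R : realType) (d : nat) (C k : R) (f : Rvec R d -> R) :
    Prop :=
  (forall x, @cube R d x -> `|f x| <= C * Num.sqrt k) /\
  exists B : set (Rvec R d),
    [/\ measurable B, (unif_cube R d B <= (C / k)%:E)%E &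
        forall x, @cube R d x -> ~ B x -> f x = 0].

(* Compactly supported wavelet bases of Cohen-Daubechies-Vial type of
   regularity S, given by their characteristic properties: localization,
   multiresolution, reproduction of polynomials of degree at most S - 1, and
   { Phi_{J0,m}, Psi^iota_{l,m} } being an orthonormal system with dense span
   in L^2 of the cube. *)
Record cdv_basis (R : realType) (d S : nat) (w : wavelet_system R d) : Prop := {
  cdv_scale : (S <= 2 ^ ws_J0 w)%N;
  cdv_card : exists c C : R, [/\ 0 < c, 0 < C & forall l, (ws_J0 w <= l)%N ->
    c * (2 ^ (l * d))%:R <= #|ws_Z w l|%:R <= C * (2 ^ (l * d))%:R];
  cdv_Phi_measurable : forall j (m : ws_Z w j), (ws_J0 w <= j)%N ->
    measurable_fun setT (ws_Phi m);
  cdv_Psi_measurable : forall i l (m : ws_Z w l), (ws_J0 w <= l)%N ->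
    i != iota0 d -> measurable_fun setT (ws_Psi i m);
  cdv_localized : exists C : R, [/\ 0 < C,
    (forall j (m : ws_Z w j), (ws_J0 w <= j)%N ->
       localized C (resolution d j)%:R (ws_Phi m)) &
    (forall i l (m : ws_Z w l), (ws_J0 w <= l)%N -> i != iota0 d ->
       localized C (resolution d l)%:R (ws_Psi i m))];
  cdv_Phi_orthonormal : forall j (m m' : ws_Z w j), (ws_J0 w <= j)%N ->
    inner (ws_Phi m) (ws_Phi m') = (m == m')%:R;
  cdv_Phi_Psi_orthogonal : forall (m : ws_Z w (ws_J0 w)) i l (m' : ws_Z w l),
    (ws_J0 w <= l)%N -> i != iota0 d -> inner (ws_Phi m) (ws_Psi i m') = 0;
  cdv_Psi_orthonormal : forall i l (m m' : ws_Z w l),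
    (ws_J0 w <= l)%N -> i != iota0 d ->
    inner (ws_Psi i m) (ws_Psi i m') = (m == m')%:R;
  cdv_Psi_orthogonal : forall i l (m : ws_Z w l) i' l' (m' : ws_Z w l'),
    (ws_J0 w <= l)%N -> i != iota0 d -> (ws_J0 w <= l')%N -> i' != iota0 d ->
    (i, l) != (i', l') -> inner (ws_Psi i m) (ws_Psi i' m') = 0;
  cdv_total : forall f : Rvec R d -> R, f \in Lfun (unif_cube R d) 2%:E ->
    forall e : R, 0 < e -> exists L a c,
      ('N[unif_cube R d]_2%:E
         [(EFin \o (fun x => f x - @ws_comb R d w L a c x)%R)] < e%:E)%E;
  (* Multiresolution; in particular the spaces V_j are nested. *)
  cdv_multiresolution : forall j, (ws_J0 w <= j)%N ->
    ws_V w j.+1 = [set f \+ g | f in ws_V w j & g in ws_W w j];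
  cdv_polynomials : forall j, (ws_J0 w <= j)%N ->
    forall c : {ffun 'I_d -> 'I_S} -> R, ws_V w j (poly_fun c) }.

Definition unif_continuous_cube (R : realType) (d : nat) (h : Rvec R d -> R) :
    Prop :=
  forall e : R, 0 < e -> exists2 delta : R, 0 < delta &
    forall x y, @cube R d x -> @cube R d y ->
      (forall i, `|tnth x i - tnth y i| < delta) -> `|h x - h y| < e.

(* The wavelet characterization of Hoelder (Besov B^alpha_oo,oo) norms. *)
Definition holder_norm (R : realType) (d : nat) (w : wavelet_system R d)
    (alpha : R) (h : Rvec R d -> R) : \bar R :=
  ((2 `^ ((ws_J0 w)%:R * (alpha + d%:R / 2))
     * \big[Num.max/0]_(m : ws_Z w (ws_J0 w)) `|inner h (ws_Phi m)|)%:E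
   + ereal_sup [set y | exists i l (m : ws_Z w l),
       [/\ (ws_J0 w <= l)%N, i != iota0 d &
           y = (2 `^ (l%:R * (alpha + d%:R / 2))
                  * `|inner h (ws_Psi i m)|)%:E]])%E.

Definition holder_ball (R : realType) (d : nat) (w : wavelet_system R d)
    (alpha M : R) : set (Rvec R d -> R) :=
  [set h | [/\ measurable_fun setT h, unif_continuous_cube h &
               (holder_norm w alpha h <= M%:E)%E]].

Definition obs (R : realType) (d : nat) :=
  (Rvec R d * measurableTypeR R * measurableTypeR R)%type.

Section model.
Context (R : realType) (d : nat).
Implicit Types (P : probability (obs R d) R) (z : obs R d).

Definition obsX z : Rvec R d := z.1.1.
Definition obsA z : R := z.1.2.
Definition obsY z : R := z.2.

(* g is a version of the regression function x |-> E_P[f | X = x]. *)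
Definition is_cond_exp P (f : obs R d -> R) (g : Rvec R d -> R) : Prop :=
  [/\ measurable_fun setT g,
      P.-integrable setT (EFin \o (g \o obsX)) &
      forall B : set (Rvec R d), measurable B ->
        (\int[P]_(z in obsX @^-1` B) (g (obsX z))%:E
         = \int[P]_(z in obsX @^-1` B) (f z)%:E)%E].

(* A version of the regression function, 0 if there is none. *)
Definition cond_exp P (f : obs R d -> R) : Rvec R d -> R :=
  xget (cst 0) [set g | is_cond_exp P f g].

(* x |-> E_P[(f - E_P[f | X]) (g - E_P[g | X]) | X = x]. *)
Definition cond_cov P (f g : obs R d -> R) : Rvec R d -> R :=
  cond_exp P (fun z => (f z - cond_exp P f (obsX z))
                       * (g z - cond_exp P g (obsX z))).

Definition psi P : R := fine 'E_P[cond_cov P obsA obsY \o obsX].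

Definition model (w : wavelet_system R d) (C1 C2 alpha beta M : R) :
    set (probability (obs R d) R) :=
  [set P : probability (obs R d) R |
    [/\ forall B : set (Rvec R d), measurable B ->
          P (obsX @^-1` B) = unif_cube R d B,
        {ae P, forall z, C1 <= obsA z <= C2 /\ C1 <= obsY z <= C2},
        exists2 p, is_cond_exp P obsA p & holder_ball w alpha M p &
        exists2 b, is_cond_exp P obsY b & holder_ball w beta M b]].

Definition bhat (w : wavelet_system R d) (j n : nat)
    (D : n.-tuple (obs R d)) (x : Rvec R d) : R :=
  n%:R^-1 * \sum_(i < n) obsY (tnth D i) * ws_kernel w j (obsX (tnth D i)) x.

Definition psi_NR (w : wavelet_system R d) (j n : nat)
    (D1 D2 : n.-tuple (obs R d)) : R :=
  n%:R^-1 * \sum_(i < n) obsA (tnth D2 i)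
    * (obsY (tnth D2 i) - bhat w j D1 (obsX (tnth D2 i))).

Definition mse_NR (w : wavelet_system R d) (j n : nat) P : \bar R :=
  'E_((iid_prob P n \x iid_prob P n)%E)
    [(fun D => (psi_NR w j D.1 D.2 - psi P) ^+ 2)].

End model.

Definition minimax_rate (R : realType) (d : nat) (alpha beta : R) (n : nat) :
    R :=
  if d%:R / 4 <= (alpha + beta) / 2 then n%:R^-1
  else n%:R `^ (- ((4 * alpha + 4 * beta) / (2 * alpha + 2 * beta + d%:R))).

(* The resolution used with two subsamples of size n is 2 ^ (j n * d). *)
Definition minimax_rate_optimal (R : realType) (d : nat)
    (w : wavelet_system R d) (C1 C2 alpha beta M : R) (j : nat -> nat) : Prop :=
  lesssim
    (fun n => ereal_sup
       [set mse_NR w (j n) n P | P in model w C1 C2 alpha beta M])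
    (fun n => (minimax_rate d alpha beta n)%:E).

(* Main.v *)
Require Import Defs.
From mathcomp Require Import all_boot all_order all_algebra.
From mathcomp Require Import all_classical all_reals all_analysis.
From mathcomp Require Import measurable_realfun ring lra.

(** Write p and b for the regressions of A and Y on X, s = alpha + beta, k for
    the resolution 2^(jd), Pi_j for the orthogonal projection onto V_j, and
    <.,.> for the inner product of L^2 of the cube.  Conditionally on the first
    subsample the estimator is an average of n independent copies of
    A (Y - bhat (X)), and bhat is the combination of the Phi_jm whose
    coefficients are the averages of Y Phi_jm (X) over the first subsample.  An
    average of independent copies of h has squared error at most
    E h^2 / n + (E h - t)^2 about any number t (iid_sqr_sample_mean).  Applied
    first to the second subsample and then to the coefficients, this bound
    leaves three terms (plug_in_mse):

    - the noise of the two averages, of order 1 / n;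
    - the estimation error of bhat in L^2, which is the number of coefficients
      over n because the Phi_jm are orthonormal; it enters the variance of the
      second average and is divided by n once more, whence k / n^2;
    - the squared bias (<p, b> - <p, Pi_j b>)^2, because psi is
      E (A Y) - <p, b> (mean_residual_product, psiE).

    By the multiresolution property <p, b> - <p, Pi_j b> is the sum over the
    levels l >= j of the products of the wavelet coefficients of p and b
    (scaling_formS, scaling_form_dense).  There are O(2^(ld)) products at
    level l and the Hoelder conditions bound each by M^2 2^(-l(s + d)), so that
    the bias is of order 2^(-js) = k^(-s/d): both smoothnesses contribute
    although only b is projected (bilinear_approx).

    The risk is therefore of order 1/n + k/n^2 + k^(-2s/d), uniformly over the
    model (mse_NR_le).  If n^(d/(2s)) <~ k <~ n, each term is O(1/n).  If
    k ~ n^(2d/(2s+d)), the last two terms are of the common order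
    n^(-4s/(2s+d)), which dominates 1/n because 2s < d in that case.

    All functions averaged here are built from A, Y, p, b and the wavelets, which
    are measurable and almost surely bounded; p and b inherit the bounds of A
    and Y (regression_abs_le).  Such functions form an algebra of integrable
    functions, on which expectation is linear without side conditions. *)

Set Implicit Arguments.
Unset Strict Implicit.
Unset Printing Implicit Defensive.
Import Order.TTheory GRing.Theory Num.Theory.
Local Open Scope classical_set_scope.
Local Open Scope ring_scope.

(** * Expectations of essentially bounded functions *)

Section essentially_bounded.
Context {d : measure_display} {T : measurableType d} {R : realType}
  (P : probability T R).
Implicit Types f g h : T -> R.

Definition ess_bounded f : Prop :=
  measurable_fun setT f /\ exists K : R, {ae P, forall x, `|f x| <= K}.

Lemma ess_bounded_measurable f : ess_bounded f -> measurable_fun setT f.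
Proof. by case. Qed.

Lemma ess_bounded_cst (c : R) : ess_bounded (fun=> c).
Proof. by split=> //; exists `|c|; exact: aeW. Qed.

Lemma ess_boundedD f g : ess_bounded f -> ess_bounded g ->
  ess_bounded (fun x => f x + g x).
Proof.
move=> [mf [K fK]] [mg [L gL]]; split; first exact: measurable_funD.
exists (K + L); apply: filterS2 fK gL => x fx gx.
by rewrite (le_trans (ler_normD _ _)) ?lerD.
Qed.

Lemma ess_boundedM f g : ess_bounded f -> ess_bounded g ->
  ess_bounded (fun x => f x * g x).
Proof.
move=> [mf [K fK]] [mg [L gL]]; split; first exact: measurable_funM.
exists (K * L); apply: filterS2 fK gL => x fx gx.
by rewrite normrM ler_pM.
Qed.

Lemma ess_boundedZ (c : R) f : ess_bounded f -> ess_bounded (fun x => c * f x).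
Proof. by move=> fb; apply: ess_boundedM => //; exact: ess_bounded_cst. Qed.

Lemma ess_boundedB f g : ess_bounded f -> ess_bounded g ->
  ess_bounded (fun x => f x - g x).
Proof.
move=> fb gb; apply: ess_boundedD => //.
rewrite (_ : (fun x => - g x) = (fun x => -1 * g x)); last first.
  by apply/funext => x; rewrite mulN1r.
exact: ess_boundedZ.
Qed.

Lemma ess_boundedX f : ess_bounded f -> ess_bounded (fun x => f x ^+ 2).
Proof. by move=> fb; apply: ess_boundedM. Qed.

Lemma ess_bounded_norm f : ess_bounded f -> ess_bounded (fun x => `|f x|).
Proof.
move=> [mf [K fK]]; split; first exact: measurableT_comp.
by exists K; apply: filterS fK => x; rewrite normr_id.
Qed.

Lemma normr_indic_le1 (B : set T) x : `|\1_B x : R| <= 1.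
Proof. by rewrite indicE; case: (_ \in _); rewrite ?normr1 ?normr0. Qed.

Lemma ess_bounded_indic (B : set T) : measurable B ->
  ess_bounded (\1_B : T -> R).
Proof.
move=> mB; split; first exact: measurable_indic.
by exists 1; apply: aeW => x; exact: normr_indic_le1.
Qed.

Lemma ess_bounded_sum (I : Type) (s : seq I) (Q : pred I) (F : I -> T -> R) :
  (forall i, Q i -> ess_bounded (F i)) ->
  ess_bounded (fun x => \sum_(i <- s | Q i) F i x).
Proof.
move=> Fb; elim: s => [|i s IH].
  by under eq_fun do rewrite big_nil; exact: ess_bounded_cst.
under eq_fun do rewrite big_cons.
by case Qi: (Q i) => //; apply: ess_boundedD => //; exact: Fb.
Qed.

Lemma ess_bounded_integrable f : ess_bounded f ->
  P.-integrable setT (EFin \o f).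
Proof.
move=> [mf [K fK]]; apply/integrableP; split; first exact/measurable_EFinP.
apply: (@le_lt_trans _ _ (\int[P]_x (`|K|%:E))%E).
  apply: ae_ge0_le_integral => //.
    by apply: measurableT_comp => //; exact/measurable_EFinP.
  apply: filterS fK => x fx _ /=.
  by rewrite lee_fin (le_trans fx) // ler_norm.
rewrite integral_cst //= probability_setT mule1; exact: ltry.
Qed.

Lemma EFin_mean f : ess_bounded f ->
  (\int[P]_x f x)%:E = (\int[P]_x (f x)%:E)%E.
Proof.
move=> fb; rewrite /Rintegral fineK //.
by apply: integrable_fin_num => //; exact: ess_bounded_integrable.
Qed.

Lemma mean_cst (c : R) : \int[P]_x c = c.
Proof.
by rewrite Rintegral_cst //= [X in fine X]probability_setT /= mulr1.
Qed.

Lemma meanD f g : ess_bounded f -> ess_bounded g ->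
  \int[P]_x (f x + g x) = \int[P]_x f x + \int[P]_x g x.
Proof. by move=> fb gb; apply: RintegralD => //; exact: ess_bounded_integrable. Qed.

Lemma meanB f g : ess_bounded f -> ess_bounded g ->
  \int[P]_x (f x - g x) = \int[P]_x f x - \int[P]_x g x.
Proof. by move=> fb gb; apply: RintegralB => //; exact: ess_bounded_integrable. Qed.

Lemma meanZ (c : R) f : ess_bounded f ->
  \int[P]_x (c * f x) = c * \int[P]_x f x.
Proof. by move=> fb; apply: RintegralZl => //; exact: ess_bounded_integrable. Qed.

Lemma mean_sum (I : Type) (s : seq I) (Q : pred I) (F : I -> T -> R) :
  (forall i, Q i -> ess_bounded (F i)) ->
  \int[P]_x (\sum_(i <- s | Q i) F i x) = \sum_(i <- s | Q i) \int[P]_x F i x.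
Proof.
move=> Fb; elim: s => [|i s IH].
  under eq_Rintegral do rewrite big_nil.
  by rewrite mean_cst big_nil.
under eq_Rintegral do rewrite big_cons.
rewrite big_cons; case Qi: (Q i) => //.
by rewrite meanD ?IH //; [exact: Fb|exact: ess_bounded_sum].
Qed.

Lemma eq_mean_ae f g : measurable_fun setT f -> measurable_fun setT g ->
  {ae P, forall x, f x = g x} -> \int[P]_x f x = \int[P]_x g x.
Proof.
move=> mf mg fg; congr fine; apply: ae_eq_integral => //; try exact/measurable_EFinP.
by apply: filterS fg => x -> _.
Qed.

Lemma mean_ge0 f : measurable_fun setT f -> {ae P, forall x, 0 <= f x} ->
  0 <= \int[P]_x f x.
Proof.
move=> mf f0; rewrite (@eq_mean_ae f (fun x => `|f x|)) //.
- exact: Rintegral_ge0.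
- exact: measurableT_comp.
- by apply: filterS f0 => x fx; rewrite ger0_norm.
Qed.

Lemma le_mean f g : ess_bounded f -> ess_bounded g ->
  {ae P, forall x, f x <= g x} -> \int[P]_x f x <= \int[P]_x g x.
Proof.
move=> fb gb fg; rewrite -subr_ge0 -meanB //; apply: mean_ge0.
  by case: (ess_boundedB gb fb).
by apply: filterS fg => x; rewrite subr_ge0.
Qed.

Lemma mean_sqr_ge0 f : 0 <= \int[P]_x (f x ^+ 2).
Proof. by apply: Rintegral_ge0 => x _; exact: sqr_ge0. Qed.

(** The quadratic polynomial in t that gives both the Cauchy-Schwarz and the
    Bessel inequality. *)
Lemma mean_sqrD f g (t : R) : ess_bounded f -> ess_bounded g ->
  \int[P]_x ((f x + t * g x) ^+ 2) =
  \int[P]_x (f x ^+ 2) + 2 * t * \int[P]_x (f x * g x)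
    + t ^+ 2 * \int[P]_x (g x ^+ 2).
Proof.
move=> fb gb.
have fgb := ess_boundedM fb gb.
have f2b := ess_boundedX fb; have g2b := ess_boundedX gb.
rewrite -!meanZ // -!meanD //; try exact: ess_boundedZ.
  by apply: eq_Rintegral => x _; ring.
by apply: ess_boundedD => //; exact: ess_boundedZ.
Qed.

Lemma mean_cauchy_schwarz f g : ess_bounded f -> ess_bounded g ->
  (\int[P]_x (f x * g x)) ^+ 2 <= \int[P]_x (f x ^+ 2) * \int[P]_x (g x ^+ 2).
Proof.
move=> fb gb.
have key t := mean_sqrD t fb gb.
have pos t := mean_sqr_ge0 (fun x => f x + t * g x).
move: (mean_sqr_ge0 f) (mean_sqr_ge0 g) key pos.
set a := Rintegral _ _ _; set c := Rintegral _ _ _; set b := Rintegral _ _ _.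
move=> a0 c0 key pos.
have {key}{}pos t : 0 <= a + 2 * t * b + t ^+ 2 * c by rewrite -key; exact: pos.
have [c00|cn0] := eqVneq c 0.
  have [->|bn0] := eqVneq b 0; first by rewrite expr0n /= mulr_ge0.
  (* The polynomial is affine in t, and takes the value -1 at this point. *)
  have := pos (- (a + 1) / (2 * b)); rewrite c00 mulr0 addr0.
  have -> : a + 2 * (- (a + 1) / (2 * b)) * b = -1 by field.
  by rewrite lerNr oppr0 ler10.
have cp : 0 < c by rewrite lt_neqAle eq_sym cn0.
have := pos (- b / c).
have -> : a + 2 * (- b / c) * b + (- b / c) ^+ 2 * c = (a * c - b ^+ 2) / c by field.
by rewrite pmulr_lge0 ?invr_gt0 // subr_ge0.
Qed.

End essentially_bounded.

(** * Sample means under the product law *)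

Section iid_sample.
Context {d : measure_display} {T : measurableType d} {R : realType}
  (P : probability T R).

(** The recursion by which everything about samples is proved: the first
    observation is split off by the theorem of Tonelli. *)
Lemma iid_integralS n (F : n.+1.-tuple T -> \bar R) :
  measurable_fun setT F -> (forall D, 0 <= F D)%E ->
  (\int[iid_prob P n.+1]_D F D =
   \int[P]_z \int[iid_prob P n]_D F (tuple_cons (z, D)))%E.
Proof.
move=> mF F0; rewrite /= ge0_integral_distribution //.
rewrite fubini_tonelli1 //; last by move=> x /=.
exact: measurableT_comp.
Qed.

Definition sample_sum n (h : T -> R) (D : n.-tuple T) : R :=
  \sum_(i < n) h (tnth D i).

Lemma sample_sum_cons n (h : T -> R) z (D : n.-tuple T) :
  sample_sum h (tuple_cons (z, D)) = h z + sample_sum h D.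
Proof. by rewrite /sample_sum big_ord_recl; under eq_bigr do rewrite tnthS. Qed.

Lemma measurable_sample_sum n (h : T -> R) : measurable_fun setT h ->
  measurable_fun setT (@sample_sum n h).
Proof.
move=> mh; apply: measurable_sum => i.
by apply: measurableT_comp => //; exact: measurable_tnth.
Qed.

(** Bias-variance decomposition.  Keeping the centre t free lets the induction
    absorb the first observation into it: what remains is the same statement
    with t - h z in place of t. *)
Lemma iid_sqr_sample_sum n (h : T -> R) (t : R) : ess_bounded P h ->
  (\int[iid_prob P n]_D ((sample_sum h D - t) ^+ 2)%:E =
   (n%:R * (\int[P]_z (h z ^+ 2) - (\int[P]_z h z) ^+ 2)
    + (n%:R * \int[P]_z h z - t) ^+ 2)%:E)%E.
Proof.
move=> hb; have mh := ess_bounded_measurable hb.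
elim: n t => [|n IH] t.
  rewrite /= integral_dirac //=; last first.
    apply/measurable_EFinP; apply: measurable_funX; apply: measurable_funB => //.
    exact: measurable_sample_sum.
  by rewrite diracT mul1e /sample_sum big_ord0 !mul0r !add0r.
rewrite (@iid_integralS n (fun D => ((sample_sum h D - t) ^+ 2)%:E)); first last.
- by move=> D; rewrite lee_fin sqr_ge0.
- apply/measurable_EFinP; apply: measurable_funX; apply: measurable_funB => //.
  exact: measurable_sample_sum.
under eq_integral => z _.
  under eq_integral => D _.
    rewrite sample_sum_cons (_ : h z + _ - t = sample_sum h D - (t - h z)); last by ring.
    over.
  rewrite IH; over.
rewrite /=; set m := Rintegral P setT h; set q := Rintegral _ _ _.
have e z : n%:R * (q - m ^+ 2) + (n%:R * m - (t - h z)) ^+ 2 =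
  (n%:R * (q - m ^+ 2) + (n%:R * m - t) ^+ 2) + (h z ^+ 2 + (2 * (n%:R * m - t)) * h z).
  ring.
under eq_integral do rewrite e.
have hb2 := ess_boundedX hb.
have hb3 := ess_boundedZ (2 * (n%:R * m - t)) hb.
rewrite -EFin_mean; last first.
  apply: ess_boundedD; first exact: ess_bounded_cst.
  exact: ess_boundedD.
rewrite meanD ?mean_cst ?meanD ?meanZ //; [|exact: ess_bounded_cst|exact: ess_boundedD].
by rewrite -/m -/q -natr1; congr EFin; ring.
Qed.

Definition sample_mean n (h : T -> R) (D : n.-tuple T) : R :=
  n%:R^-1 * sample_sum h D.

Lemma measurable_sample_mean n (h : T -> R) : measurable_fun setT h ->
  measurable_fun setT (@sample_mean n h).
Proof.
by move=> mh; apply: measurable_funM => //; exact: measurable_sample_sum.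
Qed.

(** The variance is replaced by the second moment, which is what boundedness and
    orthonormality control. *)
Lemma iid_sqr_sample_mean n (h : T -> R) (t : R) : (0 < n)%N -> ess_bounded P h ->
  (\int[iid_prob P n]_D ((sample_mean h D - t) ^+ 2)%:E <=
   (n%:R^-1 * \int[P]_z (h z ^+ 2) + (\int[P]_z h z - t) ^+ 2)%:E)%E.
Proof.
move=> n0 hb; have mh := ess_bounded_measurable hb.
have nN0 : n%:R != 0 :> R by rewrite pnatr_eq0 -lt0n.
under eq_integral => D _.
  rewrite (_ : sample_mean h D - t = n%:R^-1 * (sample_sum h D - n%:R * t)); last first.
    by rewrite mulrBr mulKf.
  rewrite exprMn EFinM; over.
rewrite ge0_integralZl //; last first.
all: rewrite ?lee_fin ?sqr_ge0 //.
- by move=> D _; rewrite lee_fin sqr_ge0.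
- apply/measurable_EFinP; apply: measurable_funX; apply: measurable_funB => //.
  exact: measurable_sample_sum.
rewrite iid_sqr_sample_sum // -EFinM lee_fin.
set m := Rintegral P setT h; set q := Rintegral _ _ _.
have -> : n%:R^-1 ^+ 2 * (n%:R * (q - m ^+ 2) + (n%:R * m - n%:R * t) ^+ 2) =
  n%:R^-1 * q + (m - t) ^+ 2 - n%:R^-1 * m ^+ 2 by field.
by rewrite lerBlDr lerDl mulr_ge0 ?sqr_ge0 ?invr_ge0.
Qed.

End iid_sample.

(** * Regression functions of bounded variables *)

Section regression.
Import HBSimple.
Context {dT dS : measure_display} {T : measurableType dT}
  {S : measurableType dS} {R : realType}.
Context (P : probability T R) (U : probability S R) (X : T -> S).
Context (mX : measurable_fun setT X).
Context (hX : forall B : set S, measurable B -> P (X @^-1` B) = U B).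

(** The conditional expectation property with the observation space and the
    design map X left abstract. *)
Definition regression_of (f : T -> R) (g : S -> R) : Prop :=
  [/\ measurable_fun setT g,
      P.-integrable setT (EFin \o (g \o X)) &
      forall B : set S, measurable B ->
        (\int[P]_(z in X @^-1` B) (g (X z))%:E
         = \int[P]_(z in X @^-1` B) (f z)%:E)%E].

Lemma ae_comp (Q : S -> Prop) :
  {ae U, forall x, Q x} -> {ae P, forall z, Q (X z)}.
Proof.
move=> [N [mN N0 QN]]; exists (X @^-1` N); split.
- by rewrite -[X in measurable X]setTI; exact: mX.
- by rewrite hX.
- by move=> z /= nQ; exact: QN.
Qed.

Lemma ess_bounded_comp (h : S -> R) :
  ess_bounded U h -> ess_bounded P (fun z => h (X z)).
Proof.
move=> [mh [K hK]]; split; first exact: measurableT_comp mX.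
by exists K; exact: ae_comp hK.
Qed.

(** A version of a regression function is only known to be integrable, not to be
    bounded, before [regression_abs_le]; hence the change of variables is first
    needed in this form. *)
Lemma eintegral_comp (g : S -> R) : measurable_fun setT g ->
  P.-integrable setT (EFin \o (g \o X)) ->
  U.-integrable setT (EFin \o g) /\
  (\int[U]_x (g x)%:E = \int[P]_z (g (X z))%:E)%E.
Proof.
move=> mg gi.
have mg' : measurable_fun setT (EFin \o g) by exact/measurable_EFinP.
have UX : forall F : S -> \bar R,
    (\int[pushforward P X]_x F x = \int[U]_x F x)%E.
  by move=> F; apply: eq_measure_integral => A mA _; exact: hX.
have ip := integrable_pushforward mX mg' gi measurableT.
split; last first.
  by rewrite -UX (integral_pushforward mX).
case/integrableP: ip => _ fin; apply/integrableP; split => //.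
by rewrite -UX.
Qed.

Lemma mean_comp (h : S -> R) : ess_bounded U h ->
  \int[P]_z h (X z) = \int[U]_x h x.
Proof.
move=> hb; congr fine; rewrite (proj2 (eintegral_comp _ _)) //.
- exact: ess_bounded_measurable hb.
- exact: ess_bounded_integrable (ess_bounded_comp hb).
Qed.

Lemma regression_indic (f : T -> R) (g : S -> R) (B : set S) :
  regression_of f g -> measurable B ->
  \int[U]_x (g x * \1_B x) = \int[P]_z (f z * \1_B (X z)).
Proof.
move=> [mg gi fg] mB.
have mXB : measurable (X @^-1` B).
  by rewrite -[X in measurable X]setTI; exact: mX.
have := fg _ mB.
rewrite integral_mkcond [in RHS]integral_mkcond !epatch_indic => e.
congr fine; rewrite (proj2 (eintegral_comp (g := fun x => g x * \1_B x) _ _)).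
- exact: e.
- by apply: measurable_funM.
- apply: (le_integrable measurableT _ _ gi).
    apply/measurable_EFinP; apply: measurable_funM.
      exact: measurableT_comp mX.
    by apply: measurableT_comp mX; exact: measurable_indic.
  by move=> z _ /=; rewrite lee_fin normrM ler_piMr // normr_indic_le1.
Qed.

(** Integrating c g - K over the set where it is positive gives at most the
    integral of c f - K over the preimage, which is nonpositive; so that set is
    null.  The constant c is used with the values 1 and -1 only, which yields
    the two-sided bound. *)
Lemma regression_le (f : T -> R) (g : S -> R) (c K : R) :
  ess_bounded P f -> regression_of f g ->
  {ae P, forall z, c * f z <= K} -> {ae U, forall x, c * g x <= K}.
Proof.
move=> fb cg fK; have [mg gi _] := cg.
have [gU _] := eintegral_comp mg gi.
pose B := [set x | K < c * g x].
have mcg : measurable_fun setT (fun x => c * g x) by exact: measurable_funM.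
have mB : measurable B.
  have := mcg measurableT _ (measurable_itv `]K, +oo[).
  by rewrite setTI; congr measurable; apply/seteqP; split=> x /=; rewrite in_itv /= andbT.
have mI : measurable_fun setT (\1_B : S -> R) by exact: measurable_indic.
have iM (h : S -> R) : U.-integrable setT (EFin \o h) ->
    U.-integrable setT (EFin \o (fun x => h x * \1_B x)).
  move=> hi; have mh : measurable_fun setT h.
    by apply/measurable_EFinP; exact: measurable_int hi.
  apply: (le_integrable measurableT _ _ hi).
    by apply/measurable_EFinP; exact: measurable_funM.
  by move=> z _ /=; rewrite lee_fin normrM ler_piMr // normr_indic_le1.
have Ib' : ess_bounded U (\1_B : S -> R) by exact: ess_bounded_indic.
have Ib := ess_bounded_comp Ib'.
pose phi x := c * (g x * \1_B x) - K * \1_B x.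
have phiE x : phi x = (c * g x - K) * \1_B x by rewrite /phi; ring.
have phi0 x : 0 <= phi x.
  rewrite phiE indicE; case: (boolP (x \in B)) => [|_]; last by rewrite mulr0.
  by rewrite inE /B /= mulr1 subr_ge0 => /ltW.
have phii : U.-integrable setT (EFin \o phi).
  rewrite /phi; apply: (@integrableB _ _ _ U _ measurableT
     (fun x => (c * (g x * \1_B x))%:E) (fun x => (K * \1_B x)%:E)).
    by apply: (integrableZl _ _ (iM _ gU)).
  by apply: ess_bounded_integrable; exact: ess_boundedZ.
have le0 : \int[U]_x phi x <= 0.
  rewrite RintegralB //; last 2 first.
  - exact: (integrableZl _ _ (iM _ gU)).
  - by apply: ess_bounded_integrable; exact: ess_boundedZ.
  rewrite RintegralZl //; last exact: iM.
  rewrite (regression_indic cg mB) meanZ //.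
  rewrite -(mean_comp Ib') -!meanZ //; last exact: ess_boundedM.
  rewrite subr_le0; apply: le_mean.
  - by apply: ess_boundedZ; exact: ess_boundedM.
  - exact: ess_boundedZ.
  - apply: filterS fK => z fz; rewrite mulrA ler_wpM2r //.
have ii0 : (\int[U]_x `|(EFin \o phi) x| = 0)%E.
  apply/eqP; rewrite eq_le integral_ge0 ?andbT //.
  under eq_integral => x _ do rewrite /= ger0_norm //.
  move: le0; rewrite /Rintegral -lee_fin fineK //.
  exact: integrable_fin_num.
have mphi := measurable_int _ phii.
have := (ae_eq_integral_abs U measurableT mphi).1 ii0.
apply: filterS => x /(_ I) /= [] phix0; rewrite leNgt; apply/negP => Kx.
move: phix0; rewrite phiE indicE mem_set // mulr1 => /eqP.
by rewrite subr_eq0 gt_eqF.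
Qed.

Lemma regression_abs_le (f : T -> R) (g : S -> R) (K : R) :
  ess_bounded P f -> regression_of f g ->
  {ae P, forall z, `|f z| <= K} -> {ae U, forall x, `|g x| <= K}.
Proof.
move=> fb cg fK.
have l1 : {ae U, forall x, 1 * g x <= K}.
  apply: (regression_le fb cg); apply: filterS fK => z.
  by rewrite mul1r; exact: le_trans (ler_norm _).
have l2 : {ae U, forall x, -1 * g x <= K}.
  apply: (regression_le fb cg); apply: filterS fK => z.
  by rewrite mulN1r -normrN; exact: le_trans (ler_norm _).
apply: filterS2 l1 l2 => x; rewrite mul1r mulN1r => g1 g2.
by rewrite ler_norml g1 lerNl g2.
Qed.

Lemma regression_ess_bounded (f : T -> R) (g : S -> R) :
  ess_bounded P f -> regression_of f g -> ess_bounded U g.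
Proof.
move=> fb cg; split; first by case: cg.
have [_ [K fK]] := fb; exists K; exact: regression_abs_le fK.
Qed.

Lemma regression_ortho_sfun (f : T -> R) (g : S -> R) (s : {sfun S >-> R}) :
  ess_bounded P f -> regression_of f g ->
  ess_bounded U s /\ \int[P]_z (f z * s (X z)) = \int[U]_x (g x * s x).
Proof.
move=> fb cg; have gb := regression_ess_bounded fb cg.
have sE x : s x = \sum_(y <- finmap.enum_fset (fset_set (range s)))
    y * \1_(s @^-1` [set y]) x.
  by rewrite [LHS]fimfunE fsbig_finite.
have mA y : measurable (s @^-1` [set y]) by exact: measurable_sfunP.
have Ib y : ess_bounded U (\1_(s @^-1` [set y]) : S -> R) by exact: ess_bounded_indic.
rewrite (_ : (s : S -> R) = fun x => \sum_(y <- finmap.enum_fset (fset_set (range s)))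
    y * \1_(s @^-1` [set y]) x); last exact/funext.
split; first by apply: ess_bounded_sum => y _; exact: ess_boundedZ.
under eq_Rintegral do rewrite mulr_sumr.
under [RHS]eq_Rintegral do rewrite mulr_sumr.
rewrite mean_sum; last first.
  move=> y _; apply: ess_boundedM => //.
  by apply: ess_boundedZ; exact: (ess_bounded_comp (Ib y)).
rewrite mean_sum; last by move=> y _; apply: ess_boundedM => //; exact: ess_boundedZ.
apply: eq_bigr => y _.
under eq_Rintegral do rewrite mulrCA.
under [RHS]eq_Rintegral do rewrite mulrCA.
rewrite !meanZ; first by rewrite (regression_indic cg (mA y)).
  exact: ess_boundedM.
by apply: ess_boundedM => //; exact: (ess_bounded_comp (Ib y)).
Qed.

(** The defining property, known for indicators of X, extends to bounded
    functions of X by approximation with simple functions in L^1: both sides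
    change by at most K times the L^1 error, where K bounds f and g. *)
Lemma regression_ortho (f : T -> R) (g h : S -> R) :
  ess_bounded P f -> regression_of f g -> ess_bounded U h ->
  \int[P]_z (f z * h (X z)) = \int[U]_x (g x * h x).
Proof.
move=> fb cg hb; have gb := regression_ess_bounded fb cg.
have [_ [K0 fK0]] := fb.
pose K := `|K0|.
have fK : {ae P, forall z, `|f z| <= K}.
  by apply: filterS fK0 => z fz; rewrite (le_trans fz) ?ler_norm.
have gK := regression_abs_le fb cg fK.
apply/eqP; rewrite -subr_eq0 -normr_le0; apply/ler_addgt0Pr => e e0.
rewrite add0r.
(* The two errors add up to 2 K times the L^1 error; the 1 allows K = 0. *)
have K1 : 0 < 2 * K + 1 by rewrite ltr_wpDl // mulr_ge0 // normr_ge0.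
have [s [_ _ s0]] := approximation_sfun_integrable measurableT
  (ess_bounded_integrable hb).
have /s0 [n _ /(_ _ (leqnn n)) /=] :
    nbhs (0 : \bar R)%E [set y : \bar R | (y < (e / (2 * K + 1))%:E)%E].
  apply: open_nbhs_nbhs; split; first exact: open_ereal_lt_ereal.
  by rewrite /= lte_fin divr_gt0.
have [sb sE] := regression_ortho_sfun (s n) fb cg.
have db := ess_boundedB hb sb.
have adb := ess_bounded_norm db.
move=> small.
have {}small : \int[U]_x `|h x - s n x| < e / (2 * K + 1).
  by rewrite -lte_fin (EFin_mean adb); exact: small.
have hXb := ess_bounded_comp hb; have sXb := ess_bounded_comp sb.
have dXb := ess_bounded_comp db.
have adXb := ess_bounded_comp adb.
have -> : \int[P]_z (f z * h (X z)) - \int[U]_x (g x * h x) =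
    \int[P]_z (f z * (h (X z) - s n (X z))) - \int[U]_x (g x * (h x - s n x)).
  under [in RHS]eq_Rintegral do rewrite mulrBr.
  under [X in _ = _ - X]eq_Rintegral do rewrite mulrBr.
  rewrite meanB; [|exact: ess_boundedM..].
  rewrite meanB; [|exact: ess_boundedM..].
  rewrite sE; ring.
have b1 : `|\int[P]_z (f z * (h (X z) - s n (X z)))| <= K * \int[U]_x `|h x - s n x|.
  have fdb := ess_boundedM fb dXb.
  apply: (le_trans (le_normr_Rintegral measurableT (ess_bounded_integrable fdb))).
  rewrite -(mean_comp adb) -meanZ //; apply: le_mean.
  - exact: ess_bounded_norm.
  - exact: ess_boundedZ.
  - by apply: filterS fK => z fz; rewrite normrM ler_wpM2r.
have b2 : `|\int[U]_x (g x * (h x - s n x))| <= K * \int[U]_x `|h x - s n x|.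
  have gdb := ess_boundedM gb db.
  apply: (le_trans (le_normr_Rintegral measurableT (ess_bounded_integrable gdb))).
  rewrite -meanZ //; apply: le_mean.
  - exact: ess_bounded_norm.
  - exact: ess_boundedZ.
  - by apply: filterS gK => z fz; rewrite normrM ler_wpM2r.
rewrite (le_trans (ler_normB _ _)) // (le_trans (lerD b1 b2)) //.
set I := Rintegral _ _ _ in small *.
have I0 : 0 <= I by exact: Rintegral_ge0.
move: small; rewrite ltr_pdivlMr // => small.
by rewrite -mulrDl (le_trans _ (ltW small)) // mulrC ler_wpM2l //; lra.
Qed.

(** The regression function is the Radon-Nikodym derivative, with respect to
    the law of X, of the signed measure mapping B to the integral of f over the
    event that X is in B. *)
Lemma regression_exists (f : T -> R) : ess_bounded P f ->
  exists g, regression_of f g.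
Proof.
move=> fb; have fi := ess_bounded_integrable fb.
(* The charge structure of a pushforward depends on the measurability of the
   map and is not found by inference. *)
pose nu := measure_function_pushforward__canonical__charge_Charge
  (induced_charge fi) mX.
have nuE B : nu B = (\int[P]_(z in X @^-1` B) (f z)%:E)%E by [].
have numu : nu `<< U.
  apply/null_content_dominatesP => B mB UB; rewrite nuE.
  have mXB : measurable (X @^-1` B) by rewrite -[X in measurable X]setTI; exact: mX.
  apply: null_set_integral => //.
    apply: measurable_funTS; exact: measurable_int fi.
  exact: (etrans (hX mB) UB).
have gfin := Radon_Nikodym_fin_num _ numu.
have gi := Radon_Nikodym_integrable numu.
pose g x := fine (Radon_Nikodym nu U x).
have gE : EFin \o g = Radon_Nikodym nu U by apply/funext => x /=; rewrite fineK.
have mg : measurable_fun setT g.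
  by apply/measurable_EFinP; rewrite gE; exact: measurable_int gi.
have UX : forall D (F : S -> \bar R),
    (\int[pushforward P X]_(x in D) F x = \int[U]_(x in D) F x)%E.
  by move=> D F; apply: eq_measure_integral => A mA _; exact: hX.
have gXi : P.-integrable setT (EFin \o (g \o X)).
  apply/integrableP; split.
    by apply/measurable_EFinP; exact: measurableT_comp.
  have := integrableP _ _ _ gi => -[_]; rewrite -UX -gE.
  rewrite ge0_integral_pushforward //.
  apply: measurableT_comp => //; exact/measurable_EFinP.
exists g; split => // B mB.
rewrite -nuE (Radon_Nikodym_integral numu mB) -gE -UX.
rewrite (integral_pushforward mX) //; first exact/measurable_EFinP.
apply: integrableS gXi => //.
by rewrite -[X in measurable X]setTI; exact: mX.
Qed.

End regression.

(** * The uniform law charges only the cube *)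

Lemma measurable_all_coordinates (d : measure_display) (T : measurableType d)
    (n : nat) (A : set T) : measurable A ->
  measurable [set D : n.-tuple T | forall i, A (tnth D i)].
Proof.
move=> mA.
rewrite (_ : [set D | _] = \bigcap_(i in [set: 'I_n])
    ((fun D : n.-tuple T => tnth D i) @^-1` A)); last first.
  by apply/seteqP; split=> D /= DA i => [_|]; exact: DA.
apply: fin_bigcap_measurable => // i _.
by rewrite -[X in measurable X]setTI; exact: measurable_tnth.
Qed.

Lemma iid_prob_all_coordinates (d : measure_display) (T : measurableType d)
    (R : realType) (P : probability T R) (n : nat) (A : set T) :
  measurable A -> P A = 1%E ->
  iid_prob P n [set D | forall i, A (tnth D i)] = 1%E.
Proof.
move=> mA PA; elim: n => [|n IH].
  by rewrite /= diracE mem_set //= => -[].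
rewrite /= /distribution /pushforward /=.
rewrite (_ : _ @^-1` _ = A `*` [set D : n.-tuple T | forall i, A (tnth D i)]).
  rewrite product_measure1E //.
    exact: etrans (congr2 mule PA IH) (mule1 _).
  exact: measurable_all_coordinates.
apply/seteqP; split => -[z D] /=.
  move=> zD; split; first by have := zD ord0; rewrite tnth0.
  by move=> i; have := zD (lift ord0 i); rewrite tnthS.
move=> [Az DA] i; case: (unliftP ord0 i) => [j ->|->]; rewrite ?tnth0 ?tnthS //.
Qed.

(** The wavelets are bounded on the cube only; this makes them essentially
    bounded. *)
Lemma ae_cube (R : realType) (d : nat) :
  {ae unif_cube R d, forall x, @cube R d x}.
Proof.
have mI : measurable (`[0, 1] : set (measurableTypeR R)) by exact: measurable_itv.
have mC : measurable (@cube R d) by exact: measurable_all_coordinates mI.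
exists (~` @cube R d); split; first exact: measurableC.
- rewrite probability_setC // (_ : unif_cube R d _ = 1%E) ?subee //.
  apply: (iid_prob_all_coordinates _ mI).
  exact: integral_uniform_pdf1.
- by move=> x.
Qed.

(** * Wavelet expansion of the inner product of two Hoelder functions *)

Section wavelet_expansion.
Context {R : realType} {d S : nat} (w : wavelet_system R d)
  (hw : cdv_basis S w).
Local Notation U := (unif_cube R d).
Local Notation J0 := (ws_J0 w).
Implicit Types f g h r : Rvec R d -> R.

Lemma localized_ess_bounded (C k : R) f :
  measurable_fun setT f -> localized C k f -> ess_bounded U f.
Proof.
move=> mf [fC _]; split=> //; exists (C * Num.sqrt k).
by apply: filterS (ae_cube R d) => x; exact: fC.
Qed.

Lemma Phi_ess_bounded j (m : ws_Z w j) : (J0 <= j)%N -> ess_bounded U (ws_Phi m).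
Proof.
move=> jJ; have [C [_ hPhi _]] := cdv_localized hw.
exact: localized_ess_bounded (cdv_Phi_measurable hw m jJ) (hPhi _ m jJ).
Qed.

Lemma Psi_ess_bounded i l (m : ws_Z w l) : (J0 <= l)%N -> i != iota0 d ->
  ess_bounded U (ws_Psi i m).
Proof.
move=> lJ i0; have [C [_ _ hPsi]] := cdv_localized hw.
exact: localized_ess_bounded (cdv_Psi_measurable hw m lJ i0) (hPsi _ _ m lJ i0).
Qed.
Hint Resolve Phi_ess_bounded Psi_ess_bounded : core.

Lemma innerC f g : inner f g = inner g f.
Proof. by apply: eq_Rintegral => x _; rewrite mulrC. Qed.

Lemma innerDr r f g : ess_bounded U r -> ess_bounded U f -> ess_bounded U g ->
  inner r (fun x => f x + g x) = inner r f + inner r g.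
Proof.
move=> rb fb gb; rewrite /inner -meanD; [|exact: ess_boundedM..].
by apply: eq_Rintegral => x _; rewrite mulrDr.
Qed.

Lemma innerBr r f g : ess_bounded U r -> ess_bounded U f -> ess_bounded U g ->
  inner r (fun x => f x - g x) = inner r f - inner r g.
Proof.
move=> rb fb gb; rewrite /inner -meanB; [|exact: ess_boundedM..].
by apply: eq_Rintegral => x _; rewrite mulrBr.
Qed.

Lemma inner_sumr (I : finType) (Q : pred I) (c : I -> R) (F : I -> Rvec R d -> R) r :
  ess_bounded U r -> (forall i, Q i -> ess_bounded U (F i)) ->
  inner r (fun x => \sum_(i | Q i) c i * F i x) = \sum_(i | Q i) c i * inner r (F i).
Proof.
move=> rb Fb; rewrite /inner.
transitivity (\int[U]_x (\sum_(i | Q i) c i * (r x * F i x))).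
  by apply: eq_Rintegral => x _; rewrite mulr_sumr; under eq_bigr do rewrite mulrCA.
rewrite mean_sum; last by move=> i /Fb Fib; exact: ess_boundedZ (ess_boundedM _ _).
by apply: eq_bigr => i /Fb Fib; rewrite meanZ //; exact: ess_boundedM.
Qed.

Lemma scaling_comb_bounded j (c : ws_Z w j -> R) : (J0 <= j)%N ->
  ess_bounded U (fun x => \sum_m c m * ws_Phi m x).
Proof.
by move=> jJ; apply: ess_bounded_sum => m _; apply: ess_boundedZ; exact: Phi_ess_bounded.
Qed.

Lemma detail_comb_bounded l (c : d.-tuple bool -> ws_Z w l -> R) : (J0 <= l)%N ->
  ess_bounded U (fun x => \sum_(i | i != iota0 d) \sum_m c i m * ws_Psi i m x).
Proof.
move=> lJ; apply: ess_bounded_sum => i i0; apply: ess_bounded_sum => m _.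
by apply: ess_boundedZ; exact: Psi_ess_bounded.
Qed.

Lemma inner_scaling_comb j (c : ws_Z w j -> R) r : (J0 <= j)%N -> ess_bounded U r ->
  inner r (fun x => \sum_m c m * ws_Phi m x) = \sum_m c m * inner r (ws_Phi m).
Proof. by move=> jJ rb; apply: inner_sumr => // m _; exact: Phi_ess_bounded. Qed.

Lemma inner_detail_comb l (c : d.-tuple bool -> ws_Z w l -> R) r :
  (J0 <= l)%N -> ess_bounded U r ->
  inner r (fun x => \sum_(i | i != iota0 d) \sum_m c i m * ws_Psi i m x) =
  \sum_(i | i != iota0 d) \sum_m c i m * inner r (ws_Psi i m).
Proof.
move=> lJ rb.
transitivity (inner r (fun x => \sum_(i | i != iota0 d)
    1 * (fun i x => \sum_m c i m * ws_Psi i m x) i x)).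
  by apply: eq_Rintegral => x _; under [in RHS]eq_bigr do rewrite mul1r.
rewrite inner_sumr //; last first.
  by move=> i i0; apply: ess_bounded_sum => m _; apply: ess_boundedZ; exact: Psi_ess_bounded.
apply: eq_bigr => i i0; rewrite mul1r inner_sumr // => m _; exact: Psi_ess_bounded.
Qed.

(** Both functions have to be measurable here: elements of [ws_V] are arbitrary
    functions that agree almost everywhere with a combination of wavelets, so
    membership in [ws_V] is used for the wavelets themselves only. *)
Lemma inner_ae r f g : ess_bounded U r -> ess_bounded U f -> ess_bounded U g ->
  ae_eq_cube f g -> inner r f = inner r g.
Proof.
move=> [mr _] [mf _] [mg _] fg; apply: eq_mean_ae; try exact: measurable_funM.
by apply: filterS fg => x ->.
Qed.

(** This lemma, [Phi_coarse] and [Psi_coarse] are the two inclusions of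
    V_(j+1) = V_j + W_j, applied to the basis functions. *)
Lemma Phi_refines j (m : ws_Z w j.+1) : (J0 <= j)%N ->
  exists (c : ws_Z w j -> R) (c' : d.-tuple bool -> ws_Z w j -> R),
  ae_eq_cube (ws_Phi m) (fun x => \sum_m' c m' * ws_Phi m' x +
    \sum_(i | i != iota0 d) \sum_m' c' i m' * ws_Psi i m' x).
Proof.
move=> jJ.
have : ws_V w j.+1 (ws_Phi m).
  exists (fun m' => (m' == m)%:R); apply: aeW => x.
  rewrite (bigD1 m) //= eqxx mul1r big1 ?addr0 // => m' /negbTE ->.
  by rewrite mul0r.
rewrite (cdv_multiresolution hw jJ) => -[f [c fc]] [g [c' gc']] fg.
exists c, c'; apply: filterS2 fc gc' => x <- <-.
by rewrite -fg.
Qed.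

Lemma multires_coarse j f g : (J0 <= j)%N -> ws_V w j f -> ws_W w j g ->
  exists c : ws_Z w j.+1 -> R,
  ae_eq_cube (fun x => f x + g x) (fun x => \sum_m c m * ws_Phi m x).
Proof.
move=> jJ Vf Wg.
have : ws_V w j.+1 (f \+ g) by rewrite (cdv_multiresolution hw jJ); exists f => //; exists g.
by move=> [c fc]; exists c.
Qed.

Lemma Phi_coarse j (m : ws_Z w j) : (J0 <= j)%N ->
  exists c : ws_Z w j.+1 -> R,
  ae_eq_cube (ws_Phi m) (fun x => \sum_m' c m' * ws_Phi m' x).
Proof.
move=> jJ; have [||c hc] := @multires_coarse j (ws_Phi m) (fun=> 0) jJ.
- exists (fun m' => (m' == m)%:R); apply: aeW => x.
  rewrite (bigD1 m) //= eqxx mul1r big1 ?addr0 // => m' /negbTE ->.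
  by rewrite mul0r.
- exists (fun _ _ => 0); apply: aeW => x; rewrite big1 // => i _.
  by rewrite big1 // => m' _; rewrite mul0r.
- by exists c; apply: filterS hc => x; rewrite addr0.
Qed.

Lemma Psi_coarse i l (m : ws_Z w l) : (J0 <= l)%N -> i != iota0 d ->
  exists c : ws_Z w l.+1 -> R,
  ae_eq_cube (ws_Psi i m) (fun x => \sum_m' c m' * ws_Phi m' x).
Proof.
move=> lJ i0; have [||c hc] := @multires_coarse l (fun=> 0) (ws_Psi i m) lJ.
- exists (fun=> 0); apply: aeW => x; rewrite big1 // => m' _.
  by rewrite mul0r.
- exists (fun i' m' => ((i' == i) && (m' == m))%:R); apply: aeW => x.
  rewrite (bigD1 i) //= (bigD1 m) //= !eqxx mul1r big1 ?addr0; last first.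
    by move=> m' /negbTE ->; rewrite mul0r.
  rewrite big1 ?addr0 // => i' /andP[_ /negbTE ->].
  by rewrite big1 // => m' _; rewrite mul0r.
- by exists c; apply: filterS hc => x; rewrite add0r.
Qed.

(** Together with [ortho_fine], V_(j+1) = V_j + W_j in dual form.  All later
    arguments use the multiresolution property through orthogonality. *)
Lemma ortho_coarse r j : (J0 <= j)%N -> ess_bounded U r ->
  (forall m : ws_Z w j.+1, inner r (ws_Phi m) = 0) ->
  (forall m : ws_Z w j, inner r (ws_Phi m) = 0) /\
  (forall i (m : ws_Z w j), i != iota0 d -> inner r (ws_Psi i m) = 0).
Proof.
move=> jJ rb r0; have jJ1 := leqW jJ.
have comb0 (c : ws_Z w j.+1 -> R) : inner r (fun x => \sum_m c m * ws_Phi m x) = 0.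
  by rewrite inner_scaling_comb // big1 // => m _; rewrite r0 mulr0.
split=> [m|i m i0].
  have [c hc] := Phi_coarse m jJ.
  rewrite (inner_ae rb _ _ hc) ?comb0 //; first exact: Phi_ess_bounded.
  exact: scaling_comb_bounded.
have [c hc] := Psi_coarse m jJ i0.
rewrite (inner_ae rb _ _ hc) ?comb0 //; first exact: Psi_ess_bounded.
exact: scaling_comb_bounded.
Qed.

Lemma ortho_fine r j : (J0 <= j)%N -> ess_bounded U r ->
  (forall m : ws_Z w j, inner r (ws_Phi m) = 0) ->
  (forall i (m : ws_Z w j), i != iota0 d -> inner r (ws_Psi i m) = 0) ->
  forall m : ws_Z w j.+1, inner r (ws_Phi m) = 0.
Proof.
move=> jJ rb rPhi rPsi m; have [c [c' hc]] := Phi_refines m jJ.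
have b1 := scaling_comb_bounded c jJ; have b2 := detail_comb_bounded c' jJ.
rewrite (inner_ae rb _ _ hc); last 2 first.
- exact: Phi_ess_bounded (leqW jJ).
- exact: ess_boundedD.
rewrite innerDr // inner_scaling_comb // inner_detail_comb //.
rewrite big1 => [|m' _]; last by rewrite rPhi mulr0.
by rewrite big1 ?addr0 // => i i0; rewrite big1 // => m' _; rewrite rPsi ?mulr0.
Qed.

(** Orthogonality of the scaling functions to the wavelets of finer levels is
    assumed at the coarsest level only; it propagates to V_(j+1) because V_j and
    W_j are both orthogonal to the wavelets of every level above j. *)
Lemma Psi_ortho_Phi i l (m : ws_Z w l) j (m' : ws_Z w j) :
  (J0 <= j)%N -> (j <= l)%N -> i != iota0 d -> inner (ws_Psi i m) (ws_Phi m') = 0.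
Proof.
move=> jJ jl i0.
elim: j jJ jl m' => [|j IH] jJ jl m'.
  have J00 : J0 = 0%N by apply/eqP; rewrite -leqn0.
  move: m'; rewrite -J00 => m'; rewrite innerC.
  by apply: (cdv_Phi_Psi_orthogonal hw) => //; rewrite J00.
move: jJ; rewrite leq_eqVlt ltnS => /predU1P[J0j|jJ].
  move: m'; rewrite -J0j => m'; rewrite innerC.
  by apply: (cdv_Phi_Psi_orthogonal hw) => //; rewrite J0j.
have lJ : (J0 <= l)%N by rewrite (leq_trans jJ) // ltnW.
apply: ortho_fine => //; first exact: Psi_ess_bounded.
  by move=> m1; apply: IH => //; exact: ltnW.
move=> i' m1 i'0; apply: (cdv_Psi_orthogonal hw) => //.
by rewrite xpair_eqE negb_and (gtn_eqF jl) orbT.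
Qed.

Lemma inner_cauchy_schwarz f g : ess_bounded U f -> ess_bounded U g ->
  inner f g ^+ 2 <= inner f f * inner g g.
Proof. exact: mean_cauchy_schwarz. Qed.

(** The value <f, Pi_j g>, which is the mean of the cross term in the
    estimator. *)
Definition scaling_form j f g : R :=
  \sum_(m : ws_Z w j) inner f (ws_Phi m) * inner g (ws_Phi m).

Definition detail_form l f g : R :=
  \sum_(i | i != iota0 d) \sum_(m : ws_Z w l)
    inner f (ws_Psi i m) * inner g (ws_Psi i m).

Definition scaling_proj j f x : R :=
  \sum_(m : ws_Z w j) inner f (ws_Phi m) * ws_Phi m x.

Definition detail_proj l f x : R :=
  \sum_(i | i != iota0 d) \sum_(m : ws_Z w l) inner f (ws_Psi i m) * ws_Psi i m x.

Lemma inner_scaling_proj j f g : (J0 <= j)%N -> ess_bounded U f ->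
  inner f (scaling_proj j g) = scaling_form j f g.
Proof.
move=> jJ fb; rewrite inner_scaling_comb //.
by apply: eq_bigr => m _; rewrite mulrC.
Qed.

Lemma inner_detail_proj l f g : (J0 <= l)%N -> ess_bounded U f ->
  inner f (detail_proj l g) = detail_form l f g.
Proof.
move=> lJ fb; rewrite inner_detail_comb //.
by apply: eq_bigr => i _; apply: eq_bigr => m _; rewrite mulrC.
Qed.

Lemma scaling_form_Phi j f (m : ws_Z w j) : (J0 <= j)%N ->
  scaling_form j (ws_Phi m) f = inner f (ws_Phi m).
Proof.
move=> jJ; rewrite /scaling_form (bigD1 m) //= (cdv_Phi_orthonormal hw) // eqxx mul1r.
rewrite big1 ?addr0 // => m' /negbTE m'm.
by rewrite (cdv_Phi_orthonormal hw) // eq_sym m'm mul0r.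
Qed.

Lemma scaling_residual_ortho j f (m : ws_Z w j) : (J0 <= j)%N -> ess_bounded U f ->
  inner (fun x => f x - scaling_proj j f x) (ws_Phi m) = 0.
Proof.
move=> jJ fb; have Pb := Phi_ess_bounded m jJ.
rewrite innerC innerBr //; last exact: scaling_comb_bounded.
by rewrite inner_scaling_proj // scaling_form_Phi // innerC subrr.
Qed.

(** The projections of g onto V_(j+1) computed from its two orthonormal bases
    agree: their difference r lies in V_(j+1) and is orthogonal to it, hence has
    norm zero. *)
Lemma scaling_formS j f g : (J0 <= j)%N -> ess_bounded U f -> ess_bounded U g ->
  scaling_form j.+1 f g = scaling_form j f g + detail_form j f g.
Proof.
move=> jJ fb gb; have jJ1 := leqW jJ.
have pb : ess_bounded U (scaling_proj j g) by exact: scaling_comb_bounded.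
have qb : ess_bounded U (detail_proj j g) by exact: detail_comb_bounded.
have p1b : ess_bounded U (scaling_proj j.+1 g) by exact: scaling_comb_bounded.
have pqb := ess_boundedD pb qb.
pose r x := scaling_proj j.+1 g x - (scaling_proj j g x + detail_proj j g x).
have rb : ess_bounded U r by exact: ess_boundedB.
have sb := ess_boundedB gb pqb.
have sPhi1 (m : ws_Z w j.+1) :
    inner (fun x => g x - (scaling_proj j g x + detail_proj j g x)) (ws_Phi m) = 0.
  apply: ortho_fine => // [m'|i m' i0].
    have Pb := Phi_ess_bounded m' jJ.
    rewrite innerC innerBr // innerDr // inner_scaling_proj // inner_detail_proj //.
    rewrite scaling_form_Phi // innerC /detail_form big1 ?addr0 ?subrr // => i i0.
    by rewrite big1 // => m1 _; rewrite innerC Psi_ortho_Phi ?mul0r.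
  have Pb := Psi_ess_bounded m' jJ i0.
  rewrite innerC innerBr // innerDr // inner_scaling_proj // inner_detail_proj //.
  rewrite /scaling_form big1 => [|m1 _]; last by rewrite Psi_ortho_Phi ?mul0r.
  rewrite /detail_form (bigD1 i) //= (bigD1 m') //= (cdv_Psi_orthonormal hw) // eqxx mul1r.
  rewrite big1 ?addr0 => [|m1 /negbTE m1m']; last first.
    by rewrite (cdv_Psi_orthonormal hw) // eq_sym m1m' mul0r.
  rewrite big1 ?addr0 => [|i1 /andP[i10 i1i]]; last first.
    rewrite big1 // => m1 _; rewrite (cdv_Psi_orthogonal hw) ?mul0r //.
    by rewrite xpair_eqE negb_and eq_sym i1i.
  by rewrite innerC add0r subrr.
have rPhi1 (m : ws_Z w j.+1) : inner r (ws_Phi m) = 0.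
  have Pb := Phi_ess_bounded m jJ1.
  have e1 := scaling_residual_ortho m jJ1 gb; have e2 := sPhi1 m.
  rewrite innerC innerBr // in e1; rewrite innerC innerBr // in e2.
  rewrite innerC innerBr //; lra.
have [rPhi rPsi] := ortho_coarse jJ rb rPhi1.
(* Expand the second argument only: r is a combination of basis functions, all
   orthogonal to r. *)
have rr0 : inner r r = 0.
  rewrite {2}/r innerBr // innerDr // !inner_scaling_proj // inner_detail_proj //.
  have -> : scaling_form j.+1 r g = 0.
    by rewrite /scaling_form big1 // => m _; rewrite rPhi1 mul0r.
  have -> : scaling_form j r g = 0.
    by rewrite /scaling_form big1 // => m _; rewrite rPhi mul0r.
  rewrite /detail_form big1 => [|i i0]; first by rewrite addr0 subrr.
  by rewrite big1 // => m _; rewrite rPsi ?mul0r.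
have : inner f r = 0.
  apply/eqP; rewrite -sqrf_eq0 eq_le sqr_ge0 andbT.
  by rewrite (le_trans (inner_cauchy_schwarz fb rb)) // rr0 mulr0.
rewrite innerBr // innerDr // !inner_scaling_proj // inner_detail_proj //.
by move=> /eqP; rewrite subr_eq0 => /eqP.
Qed.

Lemma ws_comb_bounded L a c : ess_bounded U (ws_comb (w := w) L a c).
Proof.
apply: ess_boundedD; first exact: scaling_comb_bounded.
rewrite (_ : (fun x => _) = fun x => \sum_(l <- index_iota J0 L | (J0 <= l)%N)
    \sum_(i | i != iota0 d) \sum_m c l i m * ws_Psi i m x).
  by apply: ess_bounded_sum => l lJ; exact: detail_comb_bounded.
apply/funext => x; rewrite big_nat_cond [RHS]big_seq_cond.
by apply: eq_bigl => l; rewrite mem_index_iota; case: (J0 <= l)%N; rewrite ?andbT ?andbF.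
Qed.

(** The space V_j contains every finite wavelet combination of level below j;
    orthogonality descends from level j to all coarser levels. *)
Lemma inner_ws_comb0 r j L a c : (L <= j)%N -> (J0 <= j)%N -> ess_bounded U r ->
  (forall m : ws_Z w j, inner r (ws_Phi m) = 0) ->
  inner r (ws_comb (w := w) L a c) = 0.
Proof.
move=> Lj jJ rb r0.
have down k : (J0 <= k)%N -> (k <= j)%N -> forall m : ws_Z w k, inner r (ws_Phi m) = 0.
  move=> kJ /subnK jE; move: r0; rewrite -jE.
  elim: (j - k)%N => [|n IH] // r1; apply: IH.
  exact: (ortho_coarse (leq_trans kJ (leq_addl _ _)) rb r1).1.
(* Extending the levels by zero below J0 turns the sum into one over 'I_L. *)
pose D l x : R := if (J0 <= l < L)%N then
  \sum_(i | i != iota0 d) \sum_m c l i m * ws_Psi i m x else 0.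
have Db l : ess_bounded U (D l).
  rewrite /D; case lJL: (J0 <= l < L)%N; last exact: ess_bounded_cst.
  by have /andP[lJ _] := lJL; exact: detail_comb_bounded.
rewrite (_ : ws_comb _ _ _ = fun x =>
   \sum_m a m * ws_Phi m x + \sum_(l < L) 1 * D l x); last first.
  apply/funext => x; congr (_ + _); rewrite -(big_mkord xpredT (fun l => 1 * D l x)).
  have [JL|LJ] := leqP J0 L; last first.
    rewrite [LHS]big_geq ?(ltnW LJ) //.
    rewrite big_nat big1 // => l lL.
    by rewrite /D leqNgt (leq_trans _ LJ) ?ltnS ?mulr0 //; apply: ltnW; case/andP: lL.
  rewrite [RHS](big_cat_nat (n := J0)) //= [X in _ = X + _]big_nat [X in _ = X + _]big1 ?add0r.
    by apply: eq_big_nat => l lJL; rewrite /D lJL mul1r.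
  by move=> l /andP[_ lJ]; rewrite /D leqNgt lJ mulr0.
have sb := scaling_comb_bounded a (leqnn J0).
rewrite innerDr //; last by apply: ess_bounded_sum => l _; exact: ess_boundedZ.
rewrite inner_scaling_comb // big1 ?add0r => [|m _]; last first.
  by rewrite down ?mulr0.
rewrite inner_sumr // big1 // => l _; rewrite mul1r /D.
case lJL: (J0 <= l < L)%N; last first.
  by rewrite /inner; under eq_Rintegral do rewrite mulr0; rewrite mean_cst.
have /andP[lJ lL] := lJL.
rewrite inner_detail_comb // big1 // => i i0; rewrite big1 // => m _.
by rewrite (ortho_coarse lJ rb (down l.+1 _ _)).2 ?mulr0 ?leqW // (leq_trans lL).
Qed.

Lemma Lnorm2_lt h (e : R) : ess_bounded U h -> 0 < e ->
  ('N[U]_2%:E [(EFin \o h)%R] < e%:E)%E -> inner h h <= e ^+ 2.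
Proof.
move=> hb e0 he.
have : ('N[U]_2%:E [(EFin \o h)%R] `^ 2 <= e%:E `^ 2)%E.
  by rewrite gt0_ler_poweR ?(ltW he) // in_itv /= leey andbT ?Lnorm_ge0 // lee_fin ltW.
rewrite poweR_Lnorm ?pnatr_eq0 // poweR_EFin powR_mulrn ?(ltW e0) //.
under eq_integral => x _ do rewrite /= ?poweR_EFin powR_mulrn // real_normK ?num_real //.
by rewrite -(EFin_mean (ess_boundedX hb)) lee_fin.
Qed.

Lemma ess_bounded_Lfun2 h : ess_bounded U h -> h \in Lfun U 2%:E.
Proof.
move=> hb; rewrite inE; apply/andP; split; rewrite inE /=.
  exact: ess_bounded_measurable hb.
rewrite /finite_norm unlock /Lnorm poweR_lty //.
under eq_integral => x _ do rewrite /= ?poweR_EFin powR_mulrn // real_normK ?num_real //.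
by rewrite -(EFin_mean (ess_boundedX hb)) ltry.
Qed.

(** The error is <f - Pi_L f, g>, in which g may be replaced by its difference
    with any element of V_L; totality of the wavelets makes that difference
    small in L^2, and the norm of f - Pi_L f is at most that of f. *)
Lemma scaling_form_dense j f g (e : R) : (J0 <= j)%N ->
  ess_bounded U f -> ess_bounded U g -> 0 < e ->
  exists2 L, (j <= L)%N & `|inner f g - scaling_form L f g| <= e.
Proof.
move=> jJ fb gb e0.
have ff0 : 0 <= inner f f by exact: mean_sqr_ge0.
(* With A := <f, f> + 1, an error e / A in L^2 suffices: <f, f> <= A^2. *)
have A0 : 0 < inner f f + 1 by rewrite ltr_wpDl.
have d0 : 0 < e / (inner f f + 1) by rewrite divr_gt0.
have [L [a [c hac]]] := cdv_total hw (ess_bounded_Lfun2 gb) d0.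
exists (maxn j L); first exact: leq_maxl.
set j' := maxn j L; have jJ' : (J0 <= j')%N by rewrite (leq_trans jJ) ?leq_maxl.
have cb : ess_bounded U (ws_comb L a c) by exact: ws_comb_bounded.
have gcb := ess_boundedB gb cb.
have pb : ess_bounded U (scaling_proj j' f) by exact: scaling_comb_bounded.
pose r x := f x - scaling_proj j' f x.
have rb : ess_bounded U r by exact: ess_boundedB.
have r0 (m : ws_Z w j') : inner r (ws_Phi m) = 0 by exact: scaling_residual_ortho.
have rrE : inner r r = inner f f - scaling_form j' f f.
  rewrite {2}/r innerBr // inner_scaling_proj //.
  have -> : scaling_form j' r f = 0.
    by rewrite /scaling_form big1 // => m _; rewrite r0 mul0r.
  by rewrite subr0 innerC innerBr // inner_scaling_proj.
have rrle : inner r r <= inner f f.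
  by rewrite rrE gerBl; apply: sumr_ge0 => m _; rewrite -expr2 sqr_ge0.
have -> : inner f g - scaling_form j' f g = inner r (fun x => g x - ws_comb L a c x).
  rewrite innerBr // (inner_ws_comb0 _ _ (leq_maxr j L) jJ' rb r0) subr0.
  rewrite [RHS]innerC innerBr // inner_scaling_proj // [inner g f]innerC.
  by congr (_ - _); apply: eq_bigr => m _; rewrite mulrC.
rewrite -ler_sqr ?nnegrE ?(ltW e0) // real_normK ?num_real //.
apply: (le_trans (inner_cauchy_schwarz rb gcb)).
have := Lnorm2_lt gcb d0 hac.
have cc0 : 0 <= inner (fun x => g x - ws_comb L a c x) (fun x => g x - ws_comb L a c x).
  exact: mean_sqr_ge0.
have rr0 : 0 <= inner r r by exact: mean_sqr_ge0.
move=> small; apply: (le_trans (ler_pM rr0 cc0 rrle small)).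
rewrite expr_div_n mulrA ler_pdivrMr ?exprn_gt0 // mulrC ler_wpM2l ?sqr_ge0 //.
nra.
Qed.

Lemma holder_coefficient (a M : R) h i l (m : ws_Z w l) :
  (holder_norm w a h <= M%:E)%E -> (J0 <= l)%N -> i != iota0 d ->
  `|inner h (ws_Psi i m)| <= M * 2 `^ (- (l%:R * (a + d%:R / 2))).
Proof.
move=> hM lJ i0.
have : ((2 `^ (l%:R * (a + d%:R / 2)) * `|inner h (ws_Psi i m)|)%:E <= M%:E)%E.
  apply: le_trans hM; rewrite /holder_norm -[X in (X <= _)%E]add0e leeD //.
    by rewrite lee_fin mulr_ge0 ?powR_ge0 // bigmax_ge_id.
  by apply: ereal_sup_ubound; exists i, l, m.
by rewrite lee_fin powRN ler_pdivlMr ?powR_gt0 // mulrC.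
Qed.

(** The factors 2^(-ld/2) of the two coefficients cancel the number 2^(ld) of
    wavelets of level l. *)
Lemma detail_form_decay (alpha beta M : R) : exists2 C : R, 0 <= C &
  forall f g, (holder_norm w alpha f <= M%:E)%E ->
    (holder_norm w beta g <= M%:E)%E ->
  forall l, (J0 <= l)%N ->
    `|detail_form l f g| <= C * (2 `^ (- (alpha + beta))) ^+ l.
Proof.
have [c [C [_ C0 card]]] := cdv_card hw.
pose N : R := #|[pred i | i != iota0 d]|%:R.
exists (N * (C * M ^+ 2)).
  by rewrite mulr_ge0 ?ler0n // mulr_ge0 ?(ltW C0) ?sqr_ge0.
move=> f g fM gM l lJ.
pose B := M ^+ 2 * ((2 `^ (- (alpha + beta))) ^+ l * ((2 ^ (l * d))%:R)^-1).
have B0 : 0 <= B.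
  by rewrite mulr_ge0 ?sqr_ge0 // mulr_ge0 ?exprn_ge0 ?powR_ge0 // invr_ge0.
have term i (m : ws_Z w l) : i != iota0 d ->
    `|inner f (ws_Psi i m) * inner g (ws_Psi i m)| <= B.
  move=> i0; rewrite normrM.
  apply: (le_trans (ler_pM _ _ (holder_coefficient m fM lJ i0)
                               (holder_coefficient m gM lJ i0))) => //.
  rewrite mulrACA -expr2 -powRD; last by apply/implyP.
  have -> : - (l%:R * (alpha + d%:R / 2)) + - (l%:R * (beta + d%:R / 2)) =
     (- (alpha + beta)) * l%:R + - (l * d)%:R by rewrite natrM; field.
  rewrite powRD; last by apply/implyP.
  by rewrite powRrM powR_mulrn ?powR_ge0 // powR_invn // -natrX.
apply: (le_trans (ler_norm_sum _ _ _)).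
apply: (@le_trans _ _ (\sum_(i | i != iota0 d) \sum_(m : ws_Z w l) B)).
  apply: ler_sum => i i0; apply: (le_trans (ler_norm_sum _ _ _)).
  by apply: ler_sum => m _; exact: term.
have /andP[_ cl] := card l lJ.
have pos : 0 < (2 ^ (l * d))%:R :> R by rewrite ltr0n expn_gt0.
have BC : #|ws_Z w l|%:R * B <= C * M ^+ 2 * (2 `^ (- (alpha + beta))) ^+ l.
  apply: (le_trans (ler_wpM2r B0 cl)).
  rewrite le_eqVlt; apply/orP; left; apply/eqP; rewrite /B; field.
  by rewrite gt_eqF.
rewrite !sumr_const -[B *+ _]mulr_natl -[_ *+ _]mulr_natl.
by rewrite -mulrA ler_wpM2l ?ler0n.
Qed.

(** Geometric series over the levels above j.  Only the partial sums are
    needed: they telescope to multiples of q^j - q^L. *)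
Lemma bilinear_approx (alpha beta M : R) : 0 < alpha + beta ->
  exists2 C : R, 0 <= C &
  forall f g, ess_bounded U f -> ess_bounded U g ->
    (holder_norm w alpha f <= M%:E)%E -> (holder_norm w beta g <= M%:E)%E ->
  forall j, (J0 <= j)%N ->
    `|inner f g - scaling_form j f g| <= C * (2 `^ (- (alpha + beta))) ^+ j.
Proof.
move=> ab0; have [C C0 decay] := detail_form_decay alpha beta M.
set q := 2 `^ (- (alpha + beta)) in decay *.
have q0 : 0 <= q by exact: powR_ge0.
have q1 : 0 < 1 - q.
  rewrite subr_gt0 /q powRN invf_lt1 ?powR_gt0 //.
  have {1}-> : 1 = 1 `^ (alpha + beta) :> R by rewrite powR1.
  by rewrite gt0_ltr_powR ?nnegrE ?ltr1n.
exists (C / (1 - q)); first by rewrite divr_ge0 // ltW.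
move=> f g fb gb fM gM j jJ.
have tele n : `|scaling_form (n + j) f g - scaling_form j f g| <=
    C / (1 - q) * (q ^+ j - q ^+ (n + j)).
  elim: n => [|n IH]; first by rewrite add0n !subrr normr0 mulr0.
  have nJ : (J0 <= n + j)%N by rewrite (leq_trans jJ) ?leq_addl.
  rewrite addSn scaling_formS // addrAC (le_trans (ler_normD _ _)) //.
  apply: (le_trans (lerD IH (decay f g fM gM _ nJ))).
  by rewrite exprS le_eqVlt; apply/orP; left; apply/eqP; field; rewrite gt_eqF.
apply/ler_addgt0Pr => e e0.
have [L jL Le] := scaling_form_dense jJ fb gb e0.
rewrite -(subrKA (scaling_form L f g)) (le_trans (ler_normD _ _)) // addrC lerD //.
have := tele (L - j)%N; rewrite subnK // => /le_trans; apply.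
by rewrite ler_wpM2l ?divr_ge0 ?(ltW q1) // gerBl exprn_ge0.
Qed.

End wavelet_expansion.

(** * Risk of the plug-in estimator on an orthonormal family *)

Section orthonormal_family.
Context {dS : measure_display} {S : measurableType dS} {R : realType}
  (U : probability S R) (I : finType) (phi : I -> S -> R)
  (phib : forall m, ess_bounded U (phi m))
  (phiON : forall m m', \int[U]_x (phi m x * phi m' x) = (m == m')%:R).

Lemma orthonormal_comb_bounded (c : I -> R) :
  ess_bounded U (fun x => \sum_m c m * phi m x).
Proof. by apply: ess_bounded_sum => m _; exact: ess_boundedZ. Qed.

Lemma mean_mul_comb (c : I -> R) (f : S -> R) : ess_bounded U f ->
  \int[U]_x (f x * \sum_m c m * phi m x) = \sum_m c m * \int[U]_x (f x * phi m x).
Proof.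
move=> fb.
transitivity (\int[U]_x \sum_m c m * (f x * phi m x)).
  by apply: eq_Rintegral => x _; rewrite mulr_sumr; under eq_bigr do rewrite mulrCA.
rewrite mean_sum; last by move=> m _; exact: ess_boundedZ (ess_boundedM _ _).
by apply: eq_bigr => m _; rewrite meanZ //; exact: ess_boundedM.
Qed.

Lemma mean_sqr_comb (c : I -> R) :
  \int[U]_x ((\sum_m c m * phi m x) ^+ 2) = \sum_m c m ^+ 2.
Proof.
rewrite (mean_mul_comb c (orthonormal_comb_bounded c)).
apply: eq_bigr => m _; rewrite expr2; congr (_ * _).
under eq_Rintegral do rewrite mulrC.
rewrite mean_mul_comb // (bigD1 m) //= phiON eqxx mulr1 big1 ?addr0 // => m' /negbTE m'm.
by rewrite phiON eq_sym m'm mulr0.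
Qed.

(** Nonnegativity of the squared norm of f minus its projection. *)
Lemma bessel (f : S -> R) : ess_bounded U f ->
  \sum_m (\int[U]_x (f x * phi m x)) ^+ 2 <= \int[U]_x (f x ^+ 2).
Proof.
move=> fb; pose c m := \int[U]_x (f x * phi m x).
have cb := orthonormal_comb_bounded c.
have := mean_sqr_ge0 U (fun x => f x + -1 * \sum_m c m * phi m x).
rewrite (mean_sqrD (-1) fb cb) mean_mul_comb // mean_sqr_comb.
under [X in _ + _ * X + _]eq_bigr do rewrite -expr2.
rewrite -/c; set s := \sum_m _; lra.
Qed.

End orthonormal_family.

Section plug_in_risk.
Context {dT dS : measure_display} {T : measurableType dT}
  {S : measurableType dS} {R : realType}.
Context (P : probability T R) (U : probability S R) (X : T -> S)
  (mX : measurable_fun setT X)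
  (hX : forall B : set S, measurable B -> P (X @^-1` B) = U B).
Context (I : finType) (phi : I -> S -> R)
  (phib : forall m, ess_bounded U (phi m))
  (phiON : forall m m', \int[U]_x (phi m x * phi m' x) = (m == m')%:R).
Context (A Y : T -> R) (K : R) (mA : measurable_fun setT A)
  (mY : measurable_fun setT Y)
  (AK : {ae P, forall z, `|A z| <= K}) (YK : {ae P, forall z, `|Y z| <= K}).
Context (p b : S -> R) (Ap : regression_of P X A p) (Yb : regression_of P X Y b).

Let Ab : ess_bounded P A. Proof. by split=> //; exists K. Qed.
Let Yb' : ess_bounded P Y. Proof. by split=> //; exists K. Qed.
Let pb : ess_bounded U p. Proof. exact: regression_ess_bounded mX hX A p Ab Ap. Qed.
Let bb : ess_bounded U b. Proof. exact: regression_ess_bounded mX hX Y b Yb' Yb. Qed.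
Let phiXb m : ess_bounded P (fun z => phi m (X z)).
Proof. exact: ess_bounded_comp (phib m). Qed.

Lemma mean_sqr_regression_le (f : T -> R) (g : S -> R) :
  ess_bounded P f -> regression_of P X f g -> {ae P, forall z, `|f z| <= K} ->
  \int[U]_x (g x ^+ 2) <= K ^+ 2.
Proof.
move=> fb fg fK; have gb := regression_ess_bounded mX hX fb fg.
rewrite -[leRHS](mean_cst U); apply: le_mean.
- exact: ess_boundedX.
- exact: ess_bounded_cst.
- apply: filterS (regression_abs_le mX hX fb fg fK) => x gx.
  by rewrite -real_normK ?num_real // lerXn2r ?nnegrE // (le_trans _ gx).
Qed.

Lemma mean_sqr_mul_le (f h : T -> R) : ess_bounded P f -> ess_bounded P h ->
  {ae P, forall z, `|f z| <= K} ->
  \int[P]_z ((f z * h z) ^+ 2) <= K ^+ 2 * \int[P]_z (h z ^+ 2).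
Proof.
move=> fb hb fK; have h2b := ess_boundedX hb.
rewrite -meanZ //; apply: le_mean.
- exact: ess_boundedX (ess_boundedM _ _).
- exact: ess_boundedZ.
- apply: filterS fK => z fz; rewrite exprMn ler_wpM2r ?sqr_ge0 //.
  by rewrite -real_normK ?num_real // lerXn2r ?nnegrE // (le_trans _ fz).
Qed.

Lemma plug_in_score_bounded (c : I -> R) :
  ess_bounded P (fun z => A z * (Y z - \sum_m c m * phi m (X z))).
Proof.
apply: ess_boundedM => //; apply: ess_boundedB => //.
by apply: ess_bounded_sum => m _; exact: ess_boundedZ.
Qed.

(** Mean of one term of the second average when the coefficients c of bhat are
    frozen. *)
Lemma mean_plug_in_score (c : I -> R) :
  \int[P]_z (A z * (Y z - \sum_m c m * phi m (X z))) =
  \int[P]_z (A z * Y z) - \sum_m c m * \int[U]_x (p x * phi m x).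
Proof.
have cb := orthonormal_comb_bounded phib c; have cXb := ess_bounded_comp mX hX cb.
under eq_Rintegral do rewrite mulrBr.
rewrite meanB; [|exact: ess_boundedM..].
by rewrite (regression_ortho mX hX Ab Ap cb) mean_mul_comb.
Qed.

(** From (Y - s)^2 <= 2 Y^2 + 2 s^2; orthonormality turns the second moment of
    the fitted function into the sum of the squared coefficients, whose
    expectation over the first subsample is known. *)
Lemma mean_sqr_plug_in_score (c : I -> R) :
  \int[P]_z ((A z * (Y z - \sum_m c m * phi m (X z))) ^+ 2) <=
  2 * K ^+ 4 + 2 * K ^+ 2 * \sum_m c m ^+ 2.
Proof.
have cb := orthonormal_comb_bounded phib c; have cXb := ess_bounded_comp mX hX cb.
have c2b := ess_boundedX cb; have c2Xb := ess_bounded_comp mX hX c2b.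
rewrite -(mean_sqr_comb phib phiON) -(mean_comp mX hX c2b) -meanZ //.
rewrite -[X in _ <= X + _](mean_cst P) -meanD; [|exact: ess_bounded_cst|exact: ess_boundedZ].
apply: le_mean.
- exact: ess_boundedX (plug_in_score_bounded c).
- by apply: ess_boundedD; [exact: ess_bounded_cst|exact: ess_boundedZ].
- apply: filterS2 AK YK => z Az Yz; set s := \sum_m _.
  have A2 : A z ^+ 2 <= K ^+ 2.
    by rewrite -real_normK ?num_real // lerXn2r ?nnegrE // (le_trans _ Az).
  have Y2 : Y z ^+ 2 <= K ^+ 2.
    by rewrite -real_normK ?num_real // lerXn2r ?nnegrE // (le_trans _ Yz).
  have K4 : K ^+ 4 = K ^+ 2 * K ^+ 2 by ring.
  have dev : (Y z - s) ^+ 2 <= 2 * K ^+ 2 + 2 * s ^+ 2.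
    by have := sqr_ge0 (Y z + s); nra.
  rewrite exprMn K4 (le_trans (ler_pM (sqr_ge0 _) (sqr_ge0 _) A2 dev)) //.
  by rewrite le_eqVlt; apply/orP; left; apply/eqP; ring.
Qed.

(** The estimator with the projection kernel expanded in the orthonormal
    family. *)
Definition plug_in_estimate n (D1 D2 : n.-tuple T) : R :=
  sample_mean (fun z => A z * (Y z -
    \sum_m sample_mean (fun z' => Y z' * phi m (X z')) D1 * phi m (X z))) D2.

Lemma measurable_plug_in_estimate n :
  measurable_fun setT (fun D : n.-tuple T * n.-tuple T => plug_in_estimate D.1 D.2).
Proof.
have mt (i : 'I_n) : measurable_fun setT (fun D : n.-tuple T * n.-tuple T => tnth D.2 i).
  apply: (measurableT_comp (measurable_tnth i)); exact: measurable_snd.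
apply: measurable_funM => //; apply: measurable_sum => i.
apply: measurable_funM; first exact: measurableT_comp (mt i).
apply: measurable_funB; first exact: measurableT_comp (mt i).
apply: measurable_sum => m; apply: measurable_funM; last first.
  exact: (measurableT_comp (ess_bounded_measurable (phiXb m)) (mt i)).
apply: (measurableT_comp (f := sample_mean _)); last exact: measurable_fst.
apply: measurable_sample_mean; apply: measurable_funM => //.
exact: ess_bounded_measurable (phiXb m).
Qed.

(** Conditionally on the first subsample the risk is at most
    (2 K^4 + 2 K^2 sum_m c_m^2) / n + (sum_m c_m <p, phi_m> - <p, b>)^2.  Here
    sum_m c_m <p, phi_m> is again a sample mean, of Y times the projection of p
    at X, so that averaging over the first subsample applies the same bound once
    to each coefficient and once to this mean; the Bessel inequality bounds what
    appears. *)
Lemma plug_in_mse n : (0 < n)%N ->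
  (\int[(iid_prob P n \x iid_prob P n)%E]_D
     ((plug_in_estimate D.1 D.2
       - (\int[P]_z (A z * Y z) - \int[U]_x (p x * b x))) ^+ 2)%:E <=
   (5 * K ^+ 4 / n%:R + 2 * K ^+ 4 * #|I|%:R / n%:R ^+ 2 +
    (\int[U]_x (p x * b x) -
     \sum_m (\int[U]_x (p x * phi m x)) * \int[U]_x (b x * phi m x)) ^+ 2)%:E)%E.
Proof.
move=> n0; set theta := \int[P]_z (A z * Y z) - _.
have mF : measurable_fun setT (fun D : n.-tuple T * n.-tuple T =>
    ((plug_in_estimate D.1 D.2 - theta) ^+ 2)%:E).
  apply/measurable_EFinP; apply: measurable_funX; apply: measurable_funB => //.
  exact: measurable_plug_in_estimate.
have F0 D : (0 <= ((plug_in_estimate D.1 D.2 - theta) ^+ 2)%:E :> \bar R)%E.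
  by rewrite lee_fin sqr_ge0.
rewrite fubini_tonelli1 //.
pose q m := \int[U]_x (p x * phi m x).
pose h m z := Y z * phi m (X z).
have hb m : ess_bounded P (h m) by exact: ess_boundedM.
pose hp z := Y z * \sum_m q m * phi m (X z).
have qb := orthonormal_comb_bounded phib q; have qXb := ess_bounded_comp mX hX qb.
have hpb : ess_bounded P hp by exact: ess_boundedM.
have hpE (D : n.-tuple T) : sample_mean hp D = \sum_m sample_mean (h m) D * q m.
  rewrite /sample_mean /sample_sum /hp.
  under [RHS]eq_bigr do rewrite -mulrA mulr_suml.
  rewrite -mulr_sumr exchange_big /=; congr (_ * _); apply: eq_bigr => i _.
  by rewrite mulr_sumr; apply: eq_bigr => m _; rewrite /h; ring.
(* G1 + G2 + G3 bounds the risk given the first subsample D. *)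
pose G1 (D : n.-tuple T) : \bar R := (n%:R^-1 * (2 * K ^+ 4))%:E.
pose G2 (D : n.-tuple T) : \bar R :=
  (\sum_m (n%:R^-1 * (2 * K ^+ 2))%:E * ((sample_mean (h m) D - 0) ^+ 2)%:E)%E.
pose G3 (D : n.-tuple T) : \bar R :=
  ((sample_mean hp D - \int[U]_x (p x * b x)) ^+ 2)%:E.
have n1 : 0 <= n%:R^-1 :> R by rewrite invr_ge0.
have msm m t : measurable_fun setT
    (fun D : n.-tuple T => ((sample_mean (h m) D - t) ^+ 2)%:E).
  apply/measurable_EFinP; apply: measurable_funX; apply: measurable_funB => //.
  exact: measurable_sample_mean (ess_bounded_measurable (hb m)).
have mG1 : measurable_fun setT G1 by exact: measurable_cst.
have mG2 : measurable_fun setT G2.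
  by apply: emeasurable_sum => m _; apply: measurable_funeM.
have mG3 : measurable_fun setT G3.
  apply/measurable_EFinP; apply: measurable_funX; apply: measurable_funB => //.
  exact: measurable_sample_mean (ess_bounded_measurable hpb).
have G20 D : (0 <= G2 D)%E.
  apply: sume_ge0 => m _; rewrite -EFinM lee_fin mulr_ge0 ?sqr_ge0 //.
  by rewrite mulr_ge0 // mulr_ge0 ?sqr_ge0.
have K40 : 0 <= K ^+ 4 by rewrite (_ : K ^+ 4 = (K ^+ 2) ^+ 2) ?sqr_ge0 //; ring.
apply: (@le_trans _ _ (\int[iid_prob P n]_D (G1 D + (G2 D + G3 D)))%E).
  apply: ge0_le_integral => //.
  - by move=> D _; apply: integral_ge0.
  - exact: measurable_fun_fubini_tonelli_F.
  - by apply: (emeasurable_funD mG1); exact: emeasurable_funD.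
  - move=> D _; rewrite /fubini_F /=.
    pose c m := sample_mean (h m) D.
    apply: (le_trans (iid_sqr_sample_mean theta n0 (plug_in_score_bounded c))).
    rewrite /G1 /G2 /G3; under eq_bigr do rewrite subr0 -EFinM.
    rewrite sumEFin -!EFinD lee_fin addrA lerD //.
      rewrite -mulr_sumr -mulrA -mulrDr ler_wpM2l //.
      exact: mean_sqr_plug_in_score.
    by rewrite mean_plug_in_score hpE le_eqVlt /theta; apply/orP; left; apply/eqP; ring.
rewrite ge0_integralD //; first last.
- exact: emeasurable_funD.
- by move=> D _; apply: adde_ge0 => //; rewrite lee_fin sqr_ge0.
- by move=> D _; rewrite lee_fin mulr_ge0 // mulr_ge0.
rewrite ge0_integralD //; last by move=> D _; rewrite lee_fin sqr_ge0.
rewrite integral_cst //= probability_setT mule1.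
have c0 : 0 <= n%:R^-1 * (2 * K ^+ 2).
  by rewrite mulr_ge0 // mulr_ge0 ?sqr_ge0.
rewrite ge0_integral_sum //; first last.
- by move=> m D _; rewrite -EFinM lee_fin mulr_ge0 ?sqr_ge0.
- by move=> m; apply: measurable_funeM.
have phi2 m : \int[U]_x (phi m x ^+ 2) = 1 by have := phiON m m; rewrite eqxx.
have I2 m : (\int[iid_prob P n]_D
    ((n%:R^-1 * (2 * K ^+ 2))%:E * ((sample_mean (h m) D - 0) ^+ 2)%:E) <=
    (n%:R^-1 * (2 * K ^+ 2) *
     (n%:R^-1 * K ^+ 2 + (\int[U]_x (b x * phi m x)) ^+ 2))%:E)%E.
  rewrite ge0_integralZl //; last by move=> D _; rewrite lee_fin sqr_ge0.
  rewrite [leRHS]EFinM lee_wpmul2l ?lee_fin //.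
  apply: (le_trans (iid_sqr_sample_mean 0 n0 (hb m))).
  rewrite lee_fin subr0 (regression_ortho mX hX Yb' Yb (phib m)) lerD2r ler_wpM2l //.
  apply: (le_trans (mean_sqr_mul_le Yb' (phiXb m) YK)).
  by rewrite (mean_comp mX hX (ess_boundedX (phib m))) phi2 mulr1.
apply: (le_trans (leeD (lexx _) (leeD (lee_sum _ (fun m _ => I2 m))
    (iid_sqr_sample_mean _ n0 hpb)))).
rewrite sumEFin -!EFinD lee_fin.
have hp2 : \int[P]_z (hp z ^+ 2) <= K ^+ 4.
  apply: (le_trans (mean_sqr_mul_le Yb' qXb YK)).
  rewrite (mean_comp mX hX (ess_boundedX qb)) mean_sqr_comb //.
  have -> : K ^+ 4 = K ^+ 2 * K ^+ 2 by ring.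
  rewrite ler_wpM2l ?sqr_ge0 // (le_trans (bessel phib phiON pb)) //.
  exact: mean_sqr_regression_le Ap AK.
have hp1 : \int[P]_z hp z = \sum_m q m * \int[U]_x (b x * phi m x).
  by rewrite (regression_ortho mX hX Yb' Yb qb) mean_mul_comb.
rewrite hp1 -mulr_sumr big_split /= sumr_const -[X in X + \sum_m _]mulr_natl.
have := le_trans (bessel phib phiON bb) (mean_sqr_regression_le Yb' Yb YK).
set s := \sum_m _ => sK.
rewrite -[_ - \int[U]_x _]opprB sqrrN addrA addrA lerD2r.
have nn : n%:R^-1 * (2 * K ^+ 2) * s <= n%:R^-1 * (2 * K ^+ 2) * K ^+ 2.
  by rewrite ler_wpM2l.
have := ler_wpM2l n1 hp2.
have -> : n%:R ^- 2 = n%:R^-1 * n%:R^-1 :> R by rewrite expr2 invfM.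
nra.
Qed.

End plug_in_risk.

(** * Risk bound over the model *)

(** The versions p' and b' used to define the covariance need not be the p and b
    that are known to be smooth, but every pair of versions gives the same
    value. *)
Lemma mean_residual_product (dT dS : measure_display) (T : measurableType dT)
    (S : measurableType dS) (R : realType) (P : probability T R)
    (U : probability S R) (X : T -> S) (mX : measurable_fun setT X)
    (hX : forall B : set S, measurable B -> P (X @^-1` B) = U B)
    (A Y : T -> R) (p b p' b' : S -> R) :
  ess_bounded P A -> ess_bounded P Y ->
  regression_of P X A p -> regression_of P X Y b ->
  regression_of P X A p' -> regression_of P X Y b' ->
  \int[P]_z ((A z - p' (X z)) * (Y z - b' (X z))) =
  \int[P]_z (A z * Y z) - \int[U]_x (p x * b x).
Proof.
move=> Ab Yb Ap Yb0 Ap' Yb'.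
have pb := regression_ess_bounded mX hX Ab Ap.
have pb' := regression_ess_bounded mX hX Ab Ap'.
have bb' := regression_ess_bounded mX hX Yb Yb'.
have pXb' := ess_bounded_comp mX hX pb'; have bXb' := ess_bounded_comp mX hX bb'.
have e1 := regression_ortho mX hX Ab Ap' bb'.
have e2 := regression_ortho mX hX Ab Ap bb'.
have e3 := regression_ortho mX hX Yb Yb' pb'.
have e4 := regression_ortho mX hX Yb Yb' pb.
have e5 := regression_ortho mX hX Yb Yb0 pb.
have e6 := mean_comp mX hX (ess_boundedM pb' bb').
transitivity (\int[P]_z ((A z * Y z - A z * b' (X z)) -
    (Y z * p' (X z) - p' (X z) * b' (X z)))).
  by apply: eq_Rintegral => z _; ring.
rewrite !meanB; try exact: ess_boundedM; try (apply: ess_boundedB; exact: ess_boundedM).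
have c3 : \int[U]_x (b' x * p' x) = \int[U]_x (p' x * b' x).
  by apply: eq_Rintegral => x _; rewrite mulrC.
have c4 : \int[U]_x (b' x * p x) = \int[U]_x (p x * b' x).
  by apply: eq_Rintegral => x _; rewrite mulrC.
have c5 : \int[U]_x (b x * p x) = \int[U]_x (p x * b x).
  by apply: eq_Rintegral => x _; rewrite mulrC.
rewrite e6 e3 c3 subrr subr0 e2 -c4 -e4 e5 c5; ring.
Qed.

Section model_risk.
Context {R : realType} {d : nat}.
Implicit Types P : probability (obs R d) R.

Lemma measurable_obsX : measurable_fun setT (@obsX R d).
Proof. exact: (measurableT_comp measurable_fst measurable_fst). Qed.

Lemma measurable_obsA : measurable_fun setT (@obsA R d).
Proof. exact: (measurableT_comp measurable_snd measurable_fst). Qed.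

Lemma measurable_obsY : measurable_fun setT (@obsY R d).
Proof. exact: measurable_snd. Qed.

(** The choice made by [cond_exp] falls back on the constant 0 when there is no
    regression function; boundedness excludes this case. *)
Lemma cond_expP P (f : obs R d -> R) :
  (forall B, measurable B -> P (@obsX R d @^-1` B) = unif_cube R d B) ->
  ess_bounded P f -> is_cond_exp P f (cond_exp P f).
Proof.
move=> hX fb; apply: xgetPex.
exact: regression_exists measurable_obsX hX f fb.
Qed.

Lemma psiE P (p b : Rvec R d -> R) :
  (forall B, measurable B -> P (@obsX R d @^-1` B) = unif_cube R d B) ->
  ess_bounded P (@obsA R d) -> ess_bounded P (@obsY R d) ->
  is_cond_exp P (@obsA R d) p -> is_cond_exp P (@obsY R d) b ->
  psi P = \int[P]_z (obsA z * obsY z) - inner p b.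
Proof.
move=> hX Ab Yb Ap Yb0.
have Ap' := cond_expP hX Ab; have Yb' := cond_expP hX Yb.
have pXb := ess_bounded_comp measurable_obsX hX
  (regression_ess_bounded measurable_obsX hX Ab Ap').
have bXb := ess_bounded_comp measurable_obsX hX
  (regression_ess_bounded measurable_obsX hX Yb Yb').
have Fb : ess_bounded P (fun z => (obsA z - cond_exp P (@obsA R d) (obsX z)) *
    (obsY z - cond_exp P (@obsY R d) (obsX z))).
  by apply: ess_boundedM; exact: ess_boundedB.
have [_ _ /(_ setT measurableT)] := cond_expP hX Fb.
rewrite preimage_setT => FE.
rewrite /psi unlock; etransitivity; first exact: (congr1 fine FE).
exact: (mean_residual_product measurable_obsX hX Ab Yb Ap Yb0 Ap' Yb').
Qed.

Lemma psi_NR_plug_in (w : wavelet_system R d) j n (D1 D2 : n.-tuple (obs R d)) :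
  psi_NR w j D1 D2 =
  plug_in_estimate (@obsX R d) (fun m : ws_Z w j => ws_Phi m)
    (@obsA R d) (@obsY R d) D1 D2.
Proof.
rewrite /psi_NR /plug_in_estimate {1}/sample_mean /sample_sum.
congr (_ * _); apply: eq_bigr => i _; congr (_ * (_ - _)).
rewrite /bhat /ws_kernel; set x := obsX (tnth D2 i).
under eq_bigr do rewrite mulr_sumr.
rewrite exchange_big /= mulr_sumr; apply: eq_bigr => m _.
rewrite /sample_mean /sample_sum -mulrA mulr_suml; congr (_ * _).
by apply: eq_bigr => i' _; rewrite mulrA.
Qed.

Lemma mse_NR_le (S : nat) (w : wavelet_system R d) (hw : cdv_basis S w)
    (C1 C2 alpha beta M : R) : 0 < alpha + beta ->
  exists2 C : R, 0 < C & forall j n, (ws_J0 w <= j)%N -> (0 < n)%N ->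
  forall P, model w C1 C2 alpha beta M P ->
  (mse_NR w j n P <= (C * (n%:R^-1 + (resolution d j)%:R / n%:R ^+ 2 +
     (2 `^ (- (alpha + beta)) ^+ j) ^+ 2))%:E)%E.
Proof.
move=> ab0.
have [C C0 bias] := bilinear_approx hw M ab0.
have [c [Cz [_ Cz0 card]]] := cdv_card hw.
pose K := Num.max `|C1| `|C2|.
have K0 : 0 <= K ^+ 4 by rewrite (_ : K ^+ 4 = (K ^+ 2) ^+ 2) ?sqr_ge0 //; ring.
have KCz : 0 <= 2 * K ^+ 4 * Cz by rewrite mulr_ge0 ?(ltW Cz0) // mulr_ge0.
(* One constant for the three terms; the 1 makes it positive. *)
exists (5 * K ^+ 4 + 2 * K ^+ 4 * Cz + C ^+ 2 + 1).
  by rewrite ltr_wpDl // !addr_ge0 ?sqr_ge0 // mulr_ge0.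
move=> j n jJ n0 P [hX AYb [p Ap [_ _ pM]] [b Yb [_ _ bM]]].
have bnd (a : R) : C1 <= a <= C2 -> `|a| <= K.
  move=> /andP[a1 a2]; rewrite ler_norml; apply/andP; split.
    rewrite lerNl; apply: (@le_trans _ _ (- C1)); first by rewrite lerN2.
    by rewrite (le_trans (ler_norm _)) // normrN le_max lexx.
  by rewrite (le_trans a2) // (le_trans (ler_norm _)) // le_max lexx orbT.
have AK : {ae P, forall z, `|obsA z| <= K}.
  by apply: filterS AYb => z [Az _]; exact: bnd.
have YK : {ae P, forall z, `|obsY z| <= K}.
  by apply: filterS AYb => z [_ Yz]; exact: bnd.
have Ab : ess_bounded P (@obsA R d) by split; [exact: measurable_obsA|exists K].
have Yb' : ess_bounded P (@obsY R d) by split; [exact: measurable_obsY|exists K].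
have pb := regression_ess_bounded measurable_obsX hX Ab Ap.
have bb := regression_ess_bounded measurable_obsX hX Yb' Yb.
have risk := plug_in_mse measurable_obsX hX (fun m => Phi_ess_bounded hw m jJ)
  (fun m m' => cdv_Phi_orthonormal hw m m' jJ) measurable_obsA measurable_obsY
  AK YK Ap Yb n0.
have -> : mse_NR w j n P = (\int[(iid_prob P n \x iid_prob P n)%E]_D
   ((plug_in_estimate (@obsX R d) (fun m : ws_Z w j => ws_Phi m)
    (@obsA R d) (@obsY R d) D.1 D.2 -
     (\int[P]_z (obsA z * obsY z) - \int[unif_cube R d]_x (p x * b x))) ^+ 2)%:E)%E.
  rewrite /mse_NR unlock; apply: eq_integral => D _.
  by rewrite psi_NR_plug_in (psiE hX Ab Yb' Ap Yb).
apply: (le_trans risk); rewrite lee_fin.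
have /andP[_ Zk] := card j jJ.
set k : R := (resolution d j)%:R.
have k0 : 0 <= k by exact: ler0n.
have B := bias p b pb bb pM bM j jJ.
set q := 2 `^ (- (alpha + beta)) ^+ j in B *.
have B2 : (inner p b - scaling_form w j p b) ^+ 2 <= C ^+ 2 * q ^+ 2.
  by rewrite -exprMn -real_normK ?num_real // lerXn2r ?nnegrE // (le_trans _ B).
rewrite -/(inner p b).
have n1 : 0 <= n%:R^-1 :> R by rewrite invr_ge0.
have n2 : 0 <= n%:R ^- 2 :> R by rewrite invr_ge0 sqr_ge0.
have V1 : 2 * K ^+ 4 * #|ws_Z w j|%:R / n%:R ^+ 2 <= 2 * K ^+ 4 * Cz * (k / n%:R ^+ 2).
  have K42 : 0 <= 2 * K ^+ 4 by rewrite mulr_ge0.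
  by rewrite [leRHS]mulrA ler_wpM2r // -[leRHS]mulrA; apply: (ler_wpM2l K42).
have kn : 0 <= k / n%:R ^+ 2 by rewrite mulr_ge0.
have q20 : 0 <= q ^+ 2 by exact: sqr_ge0.
have C20 : 0 <= C ^+ 2 by exact: sqr_ge0.
apply: (le_trans (lerD (lerD (lexx _) V1) B2)).
have K50 : 0 <= 5 * K ^+ 4 by rewrite mulr_ge0.
set a1 := 5 * K ^+ 4 in K50 *; set a2 := 2 * K ^+ 4 * Cz in KCz *.
set a3 := C ^+ 2 in C20 *; set x1 := n%:R^-1 in n1 *.
set x2 := k / n%:R ^+ 2 in kn *; set x3 := q ^+ 2 in q20 *.
nra.
Qed.

End model_risk.

(** * Choice of the resolution *)

Section rates.
Context {R : realType} {d : nat} (hd : (0 < d)%N).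

(** As k = 2^(jd), the squared bias 2^(-2js) is k^(-2s/d), decreasing in k. *)
Lemma bias_decay_resolution (s e C : R) (j n : nat) : 0 < s -> 0 < C -> (0 < n)%N ->
  n%:R `^ e <= C * (resolution d j)%:R ->
  (2 `^ (- s) ^+ j) ^+ 2 <= C `^ (2 * s / d%:R) * n%:R `^ (- (2 * s * e / d%:R)).
Proof.
move=> s0 C0 n0 nk.
have dN0 : d%:R != 0 :> R by rewrite pnatr_eq0 -lt0n.
have d0 : 0 < d%:R :> R by rewrite ltr0n.
have kE : (resolution d j)%:R = 2 `^ (j * d)%:R :> R by rewrite powR_mulrn // natrX.
have t0 : 0 <= 2 * s / d%:R by rewrite divr_ge0 ?(ltW d0) // mulr_ge0 // ltW.
have -> : (2 `^ (- s) ^+ j) ^+ 2 = ((resolution d j)%:R `^ (2 * s / d%:R))^-1 :> R.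
  rewrite kE -powRrM -powRN -exprM -powR_mulrn ?powR_ge0 // -powRrM; congr (_ `^ _).
  by rewrite !natrM; field.
have -> : n%:R `^ (- (2 * s * e / d%:R)) = ((n%:R `^ e) `^ (2 * s / d%:R))^-1 :> R.
  by rewrite powRN -powRrM; congr (_ `^ _)^-1; field.
have k0 : 0 < (resolution d j)%:R :> R by rewrite ltr0n expn_gt0.
have np : 0 < n%:R `^ e :> R by rewrite powR_gt0 // ltr0n.
have kp := powR_gt0 (2 * s / d%:R) k0; have npp := powR_gt0 (2 * s / d%:R) np.
rewrite (ler_pdivlMr _ _ npp) mulrC (ler_pdivrMr _ _ kp).
rewrite -powRM ?(ltW C0) ?(ltW k0) //.
by rewrite ge0_ler_powR ?nnegrE ?(ltW np) // mulr_ge0 // ltW.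
Qed.

Lemma variance_resolution (e C : R) (j n : nat) : (0 < n)%N ->
  (resolution d j)%:R <= C * n%:R `^ e ->
  (resolution d j)%:R / n%:R ^+ 2 <= C * n%:R `^ (e - 2).
Proof.
move=> n0 kn; have np : 0 < n%:R :> R by rewrite ltr0n.
rewrite ler_pdivrMr ?exprn_gt0 // -powR_mulrn ?(ltW np) // -mulrA -powRD; last first.
  by apply/implyP => _; rewrite gt_eqF.
by rewrite subrK.
Qed.

Lemma mse_bound_optimal (S : nat) (w : wavelet_system R d) (hw : cdv_basis S w)
    (C1 C2 alpha beta M : R) (j : nat -> nat) (hj : forall n, (ws_J0 w <= j n)%N)
    (K : R) (n0 : nat) : 0 < alpha + beta -> 0 < K ->
  (forall n, (n0 <= n)%N -> (0 < n)%N ->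
     n%:R^-1 + (resolution d (j n))%:R / n%:R ^+ 2 +
     (2 `^ (- (alpha + beta)) ^+ j n) ^+ 2 <= K * minimax_rate d alpha beta n) ->
  minimax_rate_optimal w C1 C2 alpha beta M j.
Proof.
move=> ab0 K0 hK; have [C C0 risk] := mse_NR_le hw C1 C2 M ab0.
exists (C * K); split; first exact: mulr_gt0.
exists (maxn n0 1) => n; rewrite geq_max => /andP[n0n n1].
apply: ge_ereal_sup => _ [P mP <-].
apply: (le_trans (risk _ _ (hj n) n1 _ mP)).
by rewrite -EFinM lee_fin -mulrA ler_wpM2l ?(ltW C0) // hK.
Qed.

End rates.

Theorem corollary7 (R : realType) (d : nat) (hd : (0 < d)%N)
    (C1 C2 alpha beta M : R) (halpha : 0 < alpha) (hbeta : 0 < beta)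
    (hM : 0 < M)
    (S : nat) (hS : (1 <= S)%N) (hSab : Num.max alpha beta < S%:R)
    (w : wavelet_system R d) (hw : cdv_basis S w)
    (j : nat -> nat) (hj : forall n : nat, (ws_J0 w <= j n)%N) :
  ((d%:R / 4 <= (alpha + beta) / 2)%R ->
   lesssim (fun n => (n%:R `^ (d%:R / (2 * alpha + 2 * beta)))%:E)
           (fun n => (resolution d (j n))%:R%:E : \bar R) ->
   lesssim (fun n => (resolution d (j n))%:R%:E)
           (fun n => n%:R%:E : \bar R) ->
   minimax_rate_optimal w C1 C2 alpha beta M j)
  /\
  (((alpha + beta) / 2 < d%:R / 4)%R ->
   asympeq (fun n => (resolution d (j n))%:R%:E)
           (fun n => (n%:R `^ (2 * d%:R / (2 * alpha + 2 * beta + d%:R)))%:E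
                     : \bar R) ->
   minimax_rate_optimal w C1 C2 alpha beta M j).
Proof.
have ab0 : 0 < alpha + beta by rewrite addr_gt0.
have d0 : 0 < d%:R :> R by rewrite ltr0n.
have dN0 : d%:R != 0 :> R by rewrite gt_eqF.
set s := alpha + beta in ab0 *.
have sN0 : s != 0 by rewrite gt_eqF.
have e2 : 2 * alpha + 2 * beta = 2 * s by rewrite /s; ring.
have e4 : 4 * alpha + 4 * beta = 4 * s by rewrite /s; ring.
have twos : 2 * s + d%:R != 0 by rewrite gt_eqF // addr_gt0 // mulr_gt0.
rewrite e2; split.
- move=> smooth [B1 [B10 [n1 lower]]] [B2 [B20 [n2 upper]]].
  pose K := 1 + B2 + B1 `^ (2 * s / d%:R).
  apply: (mse_bound_optimal hw C1 C2 M hj (K := K) (n0 := maxn n1 n2)) => //.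
    by rewrite addr_gt0 ?powR_gt0 // addr_gt0.
  move=> n; rewrite geq_max => /andP[n1n n2n] n0.
  have np : 0 < n%:R :> R by rewrite ltr0n.
  have := lower n n1n; have := upper n n2n.
  rewrite -!EFinM !lee_fin => up lo.
  have b := bias_decay_resolution hd ab0 B10 n0 lo.
  have up1 : (resolution d (j n))%:R <= B2 * n%:R `^ 1 by rewrite powRr1 // ltW.
  have v := variance_resolution n0 up1.
  rewrite /minimax_rate -/s smooth /K mulrDl mulrDl mul1r.
  have inv1 : n%:R `^ (-1) = n%:R^-1 :> R by rewrite powR_inv1 // ltW.
  rewrite (_ : 1 - 2 = -1 :> R) ?inv1 in v; last by ring.
  have ex : - (2 * s * (d%:R / (2 * s)) / d%:R) = -1.
    by field; rewrite sN0 dN0.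
  rewrite ex inv1 in b.
  by rewrite lerD // lerD.
- move=> rough [[B2 [B20 [n2 upper]]] [B1 [B10 [n1 lower]]]].
  pose K := 1 + B2 + B1 `^ (2 * s / d%:R).
  apply: (mse_bound_optimal hw C1 C2 M hj (K := K) (n0 := maxn n1 n2)) => //.
    by rewrite addr_gt0 ?powR_gt0 // addr_gt0.
  move=> n; rewrite geq_max => /andP[n1n n2n] n0.
  have np : 0 < n%:R :> R by rewrite ltr0n.
  have := lower n n1n; have := upper n n2n.
  rewrite -!EFinM !lee_fin => up lo.
  have b := bias_decay_resolution hd ab0 B10 n0 lo.
  have v := variance_resolution n0 up.
  rewrite /minimax_rate -/s [d%:R / 4 <= _]leNgt rough /= /K mulrDl mulrDl mul1r e4 e2.
  have ex1 : 2 * d%:R / (2 * s + d%:R) - 2 = - (4 * s / (2 * s + d%:R)).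
    by field.
  have ex2 : - (2 * s * (2 * d%:R / (2 * s + d%:R)) / d%:R) = - (4 * s / (2 * s + d%:R)).
    by field; rewrite twos dN0.
  rewrite ex1 in v; rewrite ex2 in b.
  (* This is where 2 s < d enters: it makes the exponent at least -1. *)
  have n1r : n%:R^-1 <= n%:R `^ (- (4 * s / (2 * s + d%:R))).
    rewrite -(powR_inv1 (ltW np)) ler_powR ?ler1n // lerN2.
    by rewrite ler_pdivrMr ?addr_gt0 ?mulr_gt0 //; lra.
  by rewrite lerD // lerD.
Qed.
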